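(* Let $\mathbb F$ be a field of characteristic zero, $\Gamma$ an additive subgroup of $\mathbb F$, and $s\in\mathbb F$ with $s\notin\Gamma$ and $2s\in\Gamma$. Let $\widetilde{\mathcal L}[s\Gamma]$ be the associated generalized twisted $N=2$ superconformal algebra. Then $\mathrm{Der}(\widetilde{\mathcal L}[s\Gamma])=\mathrm{ad}(\widetilde{\mathcal L}[s\Gamma])\oplus\mathrm{Hom}_{\mathbb Z}(\Gamma,\mathbb F)$, where $\varphi\in\mathrm{Hom}_{\mathbb Z}(\Gamma,\mathbb F)$ is regarded as the derivation $\delta_\varphi$ of $\widetilde{\mathcal L}[s\Gamma]$.
   Context: Put $\Gamma_s=s+\Gamma$ and $s\Gamma=\Gamma\cup\Gamma_s$. The generalized twisted $N=2$ superconformal algebra $\widetilde{\mathcal L}[s\Gamma]$ is the Lie superalgebra over $\mathbb F$ with basis $\{L_\gamma,\,T_\mu,\,G_u,\,\mathfrak c\mid\gamma\in\Gamma,\ \mu\in\Gamma_s,\ u\in s\Gamma\}$, where the $L_\gamma,T_\mu,\mathfrak c$ span the even part and the $G_u$ span the odd part. The non-vanishing super brackets of basis elements are (up to super skew-symmetry; $\mathfrak c$ is central) $[L_{\gamma_1},L_{\gamma_2}]=(\gamma_1-\gamma_2)L_{\gamma_1+\gamma_2}+\frac{\gamma_1^3-\gamma_1}{12}\delta_{\gamma_1+\gamma_2,0}\mathfrak c$; $[L_\gamma,T_\mu]=-\mu T_{\mu+\gamma}$; $[T_{\mu_1},T_{\mu_2}]=\frac{\mu_1}{3}\delta_{\mu_1+\mu_2,0}\mathfrak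 c$; $[L_\gamma,G_u]=(\frac\gamma2-u)G_{u+\gamma}$; $[T_\mu,G_u]=G_{u+\mu}$; $[G_u,G_v]=2L_{u+v}+\frac13(u^2-\frac14)\delta_{u+v,0}\mathfrak c$ if $u,v\in\Gamma$; $[G_u,G_v]=-2L_{u+v}-\frac13(u^2-\frac14)\delta_{u+v,0}\mathfrak c$ if $u,v\in\Gamma_s$; $[G_u,G_v]=(v-u)T_{u+v}$ if $u\in\Gamma$, $v\in\Gamma_s$; $[G_u,G_v]=(u-v)T_{u+v}$ if $v\in\Gamma$, $u\in\Gamma_s$. For a Lie superalgebra $\mathfrak g=\mathfrak g_{\bar0}\oplus\mathfrak g_{\bar1}$ over $\mathbb F$, a homogeneous derivation of parity $[d]\in\mathbb Z_2$ is an $\mathbb F$-linear map $d:\mathfrak g\to\mathfrak g$ with $d(\mathfrak g_{\bar i})\subset\mathfrak g_{\bar i+[d]}$ for all $\bar i\in\mathbb Z_2$ and $d([x,y])=[d(x),y]+(-1)^{[d][x]}[x,d(y)]$ for all homogeneous $x,y$, where $[x]$ denotes the parity of $x$. $\mathrm{Der}(\mathfrak g)=\mathrm{Der}_{\bar0}(\mathfrak g)\oplus\mathrm{Der}_{\bar1}(\mathfrak g)$, where $\mathrm{Der}_{\bar i}(\mathfrak g)$ is the space of homogeneous derivations of parity $\bar i$, and $\mathrm{ad}(\mathfrak g)=\{\mathrm{ad}\,x:y\mapsto[x,y]\mid x\in\mathfrak g\}$ is the inner derivation algebra. $\mathrm{Hom}_{\mathbb Z}(\Gamma,\mathbb F)$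 is the set of additive group homomorphisms $\Gamma\to\mathbb F$. For $\varphi\in\mathrm{Hom}_{\mathbb Z}(\Gamma,\mathbb F)$ the derivation $\delta_\varphi$ is defined by $\delta_\varphi(L_\gamma)=\varphi(\gamma)L_\gamma$, $\delta_\varphi(T_\mu)=\frac12\varphi(2\mu)T_\mu$, $\delta_\varphi(G_\gamma)=\varphi(\gamma)G_\gamma$, $\delta_\varphi(G_\mu)=\frac12\varphi(2\mu)G_\mu$, $\delta_\varphi(\mathfrak c)=0$ for $\gamma\in\Gamma$, $\mu\in\Gamma_s$.
   Formalization: The sum is not direct, as ad L_0 = δ_φ ≠ 0 for φ(γ) = −γ; proved instead: Der = ad + Hom_Z(Γ,F), φ ↦ δ_φ is injective, and ad ∩ Hom_Z(Γ,F) is exactly F·ad L_0. Membership in Γ is taken as decidable (automatic classically). *)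

(* Defs.v *)
From HB Require Import structures.
From mathcomp Require Import all_boot all_order all_algebra finmap.
From mathcomp Require Export monalg.

Set Implicit Arguments.
Unset Strict Implicit.
Unset Printing Implicit Defensive.

Import GRing.Theory.
Local Open Scope ring_scope.

(* For a superspace g, [hom p x] says that x is homogeneous of parity p, with
   [false] the even parity and [true] the odd one; 0 has both parities. *)
Definition derivation (F : fieldType) (g : lmodType F) (hom : bool -> g -> Prop)
    (br : g -> g -> g) (p : bool) (d : g -> g) : Prop :=
  [/\ linear d,
      forall (q : bool) (x : g), hom q x -> hom (q (+) p) (d x)
    & forall (q r : bool) (x y : g), hom q x -> hom r y ->
        d (br x y) = br (d x) y + (-1) ^+ (p && q) *: br x (d y)].

(* Sets of self-maps of g are predicates on [g -> g], closed under pointwise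
   equality; [sum_maps A B] is their sum A + B. *)
Definition sum_maps (F : fieldType) (g : lmodType F) (A B : (g -> g) -> Prop)
    (d : g -> g) : Prop :=
  exists a b : g -> g, [/\ A a, B b & forall x : g, d x = a x + b x].

Definition Der (F : fieldType) (g : lmodType F) (hom : bool -> g -> Prop)
    (br : g -> g -> g) : (g -> g) -> Prop :=
  sum_maps (derivation hom br false) (derivation hom br true).

Definition inner (F : fieldType) (g : lmodType F) (br : g -> g -> g)
    (d : g -> g) : Prop :=
  exists x : g, d =1 br x.

Definition subgroup (F : fieldType) (Gamma : zmodClosed F) : Type :=
  {x : F | x \in Gamma}.

HB.instance Definition _ (F : fieldType) (Gamma : zmodClosed F) :=
  SubType.on (subgroup Gamma).
HB.instance Definition _ (F : fieldType) (Gamma : zmodClosed F) :=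
  Choice.on (subgroup Gamma).
HB.instance Definition _ (F : fieldType) (Gamma : zmodClosed F) :=
  [SubChoice_isSubZmodule of subgroup Gamma by <:].

Definition in_coset (F : fieldType) (Gamma : zmodClosed F) (s : F) : pred F :=
  [pred x | x - s \in Gamma].

Definition in_sGamma (F : fieldType) (Gamma : zmodClosed F) (s : F) : pred F :=
  [pred x | (x \in Gamma) || in_coset Gamma s x].

Inductive basis (F : fieldType) (Gamma : zmodClosed F) (s : F) : Type :=
  | BasisL of subgroup Gamma
  | BasisT of {mu : F | in_coset Gamma s mu}
  | BasisG of {u : F | in_sGamma Gamma s u}
  | BasisC.

Arguments BasisL {F Gamma s}.
Arguments BasisT {F Gamma s}.
Arguments BasisG {F Gamma s}.
Arguments BasisC {F Gamma s}.

Definition basis_code (F : fieldType) (Gamma : zmodClosed F) (s : F)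
    (b : basis Gamma s) :
    (subgroup Gamma + {mu : F | in_coset Gamma s mu} +
     ({u : F | in_sGamma Gamma s u} + unit))%type :=
  match b with
  | BasisL x => inl (inl x)
  | BasisT mu => inl (inr mu)
  | BasisG u => inr (inl u)
  | BasisC => inr (inr tt)
  end.

Definition basis_decode (F : fieldType) (Gamma : zmodClosed F) (s : F)
    (c : (subgroup Gamma + {mu : F | in_coset Gamma s mu} +
          ({u : F | in_sGamma Gamma s u} + unit))%type) : basis Gamma s :=
  match c with
  | inl (inl x) => BasisL x
  | inl (inr mu) => BasisT mu
  | inr (inl u) => BasisG u
  | inr (inr _) => BasisC
  end.

Lemma basis_codeK (F : fieldType) (Gamma : zmodClosed F) (s : F) :
  cancel (@basis_code F Gamma s) (@basis_decode F Gamma s).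
Proof. by case. Qed.

HB.instance Definition _ (F : fieldType) (Gamma : zmodClosed F) (s : F) :=
  Choice.copy (basis Gamma s) (can_type (@basis_codeK F Gamma s)).

(* The underlying space: finitely supported functions [basis Gamma s -> F]. *)
Definition tN2 (F : fieldType) (Gamma : zmodClosed F) (s : F) : lmodType F :=
  {malg F[basis Gamma s]}.

Definition parity (F : fieldType) (Gamma : zmodClosed F) (s : F)
    (b : basis Gamma s) : bool :=
  if b is BasisG _ then true else false.

Definition tN2_hom (F : fieldType) (Gamma : zmodClosed F) (s : F) (p : bool)
    (x : tN2 Gamma s) : Prop :=
  forall b : basis Gamma s, b \in msupp x -> parity b = p.

(* Basis vectors indexed by elements of F. The value 0 taken off the index set
   is a placeholder: when 2s lies in Gamma, the brackets below only use indices
   in the relevant index set. *)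
Definition tL (F : fieldType) (Gamma : zmodClosed F) (s : F) (x : F) :
    tN2 Gamma s :=
  if insub x is Some y then << BasisL y >> else 0.

Definition tT (F : fieldType) (Gamma : zmodClosed F) (s : F) (x : F) :
    tN2 Gamma s :=
  if insub x is Some y then << BasisT y >> else 0.

Definition tG (F : fieldType) (Gamma : zmodClosed F) (s : F) (x : F) :
    tN2 Gamma s :=
  if insub x is Some y then << BasisG y >> else 0.

Definition tC (F : fieldType) (Gamma : zmodClosed F) (s : F) : tN2 Gamma s :=
  << BasisC >>.

Definition bracket_GG (F : fieldType) (Gamma : zmodClosed F) (s : F)
    (u v : F) : tN2 Gamma s :=
  let cocycle := (u ^+ 2 - 4^-1) / 3 * (u + v == 0)%:R in
  match u \in Gamma, v \in Gamma with
  | true, true => 2 *: tL Gamma s (u + v) + cocycle *: tC Gamma s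
  | false, false => - 2 *: tL Gamma s (u + v) - cocycle *: tC Gamma s
  | true, false => (v - u) *: tT Gamma s (u + v)
  | false, true => (u - v) *: tT Gamma s (u + v)
  end.

Definition bracket_basis (F : fieldType) (Gamma : zmodClosed F) (s : F)
    (a b : basis Gamma s) : tN2 Gamma s :=
  match a, b with
  | BasisL x, BasisL y =>
      (val x - val y) *: tL Gamma s (val x + val y)
      + ((val x ^+ 3 - val x) / 12 * (val x + val y == 0)%:R) *: tC Gamma s
  | BasisL x, BasisT mu => - val mu *: tT Gamma s (val mu + val x)
  | BasisT mu, BasisL x => val mu *: tT Gamma s (val mu + val x)
  | BasisT mu, BasisT nu =>
      (val mu / 3 * (val mu + val nu == 0)%:R) *: tC Gamma s
  | BasisL x, BasisG u => (val x / 2 - val u) *: tG Gamma s (val u + val x)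
  | BasisG u, BasisL x => - (val x / 2 - val u) *: tG Gamma s (val u + val x)
  | BasisT mu, BasisG u => tG Gamma s (val u + val mu)
  | BasisG u, BasisT mu => - tG Gamma s (val u + val mu)
  | BasisG u, BasisG v => bracket_GG Gamma s (val u) (val v)
  | BasisC, _ | _, BasisC => 0
  end.

Definition linear_extension (F : fieldType) (Gamma : zmodClosed F) (s : F)
    (f : basis Gamma s -> tN2 Gamma s) (x : tN2 Gamma s) : tN2 Gamma s :=
  \sum_(b <- msupp x) x@_b *: f b.

Definition bracket (F : fieldType) (Gamma : zmodClosed F) (s : F)
    (x y : tN2 Gamma s) : tN2 Gamma s :=
  linear_extension (fun a => linear_extension (bracket_basis a) y) x.

(* phi x for x in Gamma (and a placeholder 0 elsewhere). *)
Definition hom_val (F : fieldType) (Gamma : zmodClosed F)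
    (phi : {additive subgroup Gamma -> F}) (x : F) : F :=
  if insub x is Some y then phi y else 0.

Definition delta_coef (F : fieldType) (Gamma : zmodClosed F) (s : F)
    (phi : {additive subgroup Gamma -> F}) (b : basis Gamma s) : F :=
  match b with
  | BasisL x => phi x
  | BasisT mu => hom_val phi (2 * val mu) / 2
  | BasisG u =>
      if val u \in Gamma then hom_val phi (val u)
      else hom_val phi (2 * val u) / 2
  | BasisC => 0
  end.

Definition delta (F : fieldType) (Gamma : zmodClosed F) (s : F)
    (phi : {additive subgroup Gamma -> F}) : tN2 Gamma s -> tN2 Gamma s :=
  linear_extension (fun b => delta_coef phi b *: << b >>).

Arguments delta {F Gamma} s phi _.

Definition hom_derivations (F : fieldType) (Gamma : zmodClosed F) (s : F)
    (d : tN2 Gamma s -> tN2 Gamma s) : Prop :=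
  exists phi : {additive subgroup Gamma -> F}, d =1 delta s phi.

(* Main.v *)
Require Import Defs.
From HB Require Import structures.
From mathcomp Require Import all_boot all_order all_algebra finmap.
From mathcomp Require Import ring.
Set Implicit Arguments.
Unset Strict Implicit.
Unset Printing Implicit Defensive.
Import GRing.Theory.
Local Open Scope ring_scope.

(** The proof rests on the grading given by ad L_0.  Put Gamma_s = s + Gamma and
    sGamma = Gamma u Gamma_s, a subgroup of F in which Gamma has index 2.
    Writing E_w for L_w if w lies in Gamma and for T_w if w lies in Gamma_s,
    the algebra has the basis E_w, G_w (w in sGamma) and the central element c,
    and [L_0, E_w] = - w E_w, [L_0, G_w] = - w G_w.  Thus each weight space is
    spanned by one E_w and one G_w, and in weight 0 also by c.

    Let d be a homogeneous derivation.  The component of d(L_0) of weight w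
    different from 0 is [z, L_0] for the element z obtained by dividing that
    component by w, so after subtracting an inner derivation d(L_0) has weight
    0 ([sub_inner_weight0]).  This is available for every Gamma, since it needs
    no finite generation.  Applying d to [L_0, T_s] = - s T_s then forces d(L_0)
    to be a multiple of c, hence d commutes with ad L_0 and preserves weights
    ([weight_preserving]).

    If d is even, it acts on E_w, G_w by scalars f(w), h(w), up to a possible
    contribution of c in weight 0.  The brackets [T, G] and [G, G] show that
    f = h is additive on sGamma, and comparing the cocycle at two values removes
    the central contributions ([even_eigen]).  An additive function on sGamma is
    determined by its restriction phi to Gamma, because 2 w lies in Gamma; so d
    is delta_phi ([even_derivation]).  If d is odd, then d(T_mu) = f(mu) G_mu,
    and [T_mu, T_nu] being central forces f to be constant on Gamma_s; this
    constant is matched by a multiple of ad G_0, and after subtracting it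
    d = 0 ([odd_inner], [odd_derivation]).

    Conversely, inner maps are derivations by the super Jacobi identity, which
    is verified on basis vectors, and every map that scales weight w by an
    additive function of w is a derivation.  Finally, if ad x = delta_phi, then
    [x, L_0] = 0 puts x in weight 0, and [x, G_0] = 0 removes its component
    along G_0. *)

(** * Linear maps, derivations and the Leibniz rule *)

Section LinearMaps.

Variables (F : fieldType) (U W : lmodType F) (f : U -> W).
Hypothesis f_lin : linear f.

Lemma lin0 : f 0 = 0.
Proof. by have := f_lin (-1) 0 0; rewrite scaler0 addr0 scaleN1r addNr. Qed.

Lemma linD (x y : U) : f (x + y) = f x + f y.
Proof. by have := f_lin 1 x y; rewrite !scale1r. Qed.

Lemma linZ (a : F) (x : U) : f (a *: x) = a *: f x.
Proof. by have := f_lin a x 0; rewrite lin0 !addr0. Qed.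

Lemma linB (x y : U) : f (x - y) = f x - f y.
Proof. by rewrite addrC -scaleN1r f_lin scaleN1r addrC. Qed.

End LinearMaps.

Section Derivations.

Variables (F : fieldType) (g : lmodType F) (hom : bool -> g -> Prop).
Variable br : g -> g -> g.
Hypothesis br_linl : forall y, linear (br^~ y).
Hypothesis br_linr : forall x, linear (br x).
Hypothesis hom_lin : forall p a x y, hom p x -> hom p y -> hom p (a *: x + y).

Lemma derivation_lin p a d e : derivation hom br p d -> derivation hom br p e ->
  derivation hom br p (fun x => a *: d x + e x).
Proof.
case=> d_lin d_hom d_der [e_lin e_hom e_der]; split.
- move=> c x y; rewrite d_lin e_lin !scalerDr !scalerA [c * a]mulrC -!addrA.
  by congr (_ + _); rewrite addrCA.
- by move=> q x hx; apply: hom_lin; [apply: d_hom | apply: e_hom].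
move=> q r x y hx hy; rewrite (d_der q r) // (e_der q r) //.
rewrite (linD (br_linl y)) (linZ (br_linl y)) (linD (br_linr x)).
rewrite (linZ (br_linr x)) !scalerDr !scalerA [_ * a]mulrC -!addrA.
by congr (_ + _); rewrite addrCA.
Qed.

Lemma derivation_ext p d e :
  d =1 e -> derivation hom br p e -> derivation hom br p d.
Proof.
move=> de [e_lin e_hom e_der]; split.
- by move=> a x y; rewrite !de e_lin.
- by move=> q x hx; rewrite de; apply: e_hom.
- by move=> q r x y hx hy; rewrite !de (e_der q r).
Qed.

Lemma derivation0 p : (forall q, hom q 0) -> derivation hom br p (fun=> 0).
Proof.
move=> hom0; split=> [a x y|q x _|q r x y _ _]; first by rewrite scaler0 addr0.
  exact: hom0.
by rewrite (lin0 (br_linl y)) (lin0 (br_linr x)) scaler0 addr0.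
Qed.

Definition leibniz (t : F) (d : g -> g) (x y : g) : Prop :=
  d (br x y) = br (d x) y + t *: br x (d y).

Lemma leibniz_linl t d a x x' y : linear d ->
  leibniz t d x y -> leibniz t d x' y -> leibniz t d (a *: x + x') y.
Proof.
rewrite /leibniz => d_lin dx dx'.
have brl z : br (a *: x + x') z = a *: br x z + br x' z := br_linl z a x x'.
rewrite !brl !d_lin dx dx'.
have -> : br (a *: d x + d x') y = a *: br (d x) y + br (d x') y.
  exact: br_linl.
by rewrite !scalerDr !scalerA [a * t]mulrC addrACA.
Qed.

Lemma leibniz_linr t d a x y y' : linear d ->
  leibniz t d x y -> leibniz t d x y' -> leibniz t d x (a *: y + y').
Proof.
rewrite /leibniz => d_lin dy dy'.
rewrite br_linr !d_lin dy dy' !br_linr.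
by rewrite !scalerDr !scalerA [a * t]mulrC addrACA.
Qed.

Lemma leibniz0l t d y : linear d -> leibniz t d 0 y.
Proof.
move=> d_lin; rewrite /leibniz (lin0 (br_linl y)) (lin0 d_lin).
by rewrite (lin0 (br_linl y)) (lin0 (br_linl (d y))) scaler0 addr0.
Qed.

Lemma leibniz0r t d x : linear d -> leibniz t d x 0.
Proof.
move=> d_lin; rewrite /leibniz (lin0 (br_linr x)) (lin0 d_lin).
by rewrite (lin0 (br_linr x)) (lin0 (br_linr (d x))) scaler0 addr0.
Qed.

End Derivations.

(** * The index group sGamma and the structure constants *)

Section IndexGroup.

Variables (F : fieldType).
Variables (Gamma : zmodClosed F) (s : F).
Hypotheses (s_notin : s \notin Gamma) (s2_in : 2 * s \in Gamma).

Local Notation sGamma := (in_sGamma Gamma s).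

Lemma sGammaE x : (x \in sGamma) = (x \in Gamma) || (x - s \in Gamma).
Proof. by []. Qed.

Lemma coset_notin x : x - s \in Gamma -> x \notin Gamma.
Proof.
move=> xs; apply: contra s_notin => xG.
by have := rpredB xG xs; rewrite opprB addrCA subrr addr0.
Qed.

Lemma Gamma_sGamma x : x \in Gamma -> x \in sGamma.
Proof. by rewrite sGammaE => ->. Qed.

Lemma coset_sGamma x : x - s \in Gamma -> x \in sGamma.
Proof. by rewrite sGammaE orbC => ->. Qed.

Lemma sGamma_coset x : x \in sGamma -> x \notin Gamma -> x - s \in Gamma.
Proof. by rewrite sGammaE; case: (x \in Gamma). Qed.

Lemma coset_cosetD x y :
  x - s \in Gamma -> y - s \in Gamma -> x + y \in Gamma.
Proof.
move=> xs ys; have -> : x + y = (x - s) + (y - s) + 2 * s by ring.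
by rewrite rpredD // rpredD.
Qed.

Lemma Gamma_cosetD x y :
  x \in Gamma -> y - s \in Gamma -> x + y - s \in Gamma.
Proof. by move=> xG ys; rewrite -addrA; apply: rpredD. Qed.

Lemma sGammaN x : x \in sGamma -> - x \in sGamma.
Proof.
rewrite !sGammaE rpredN => /orP[->//|xs]; apply/orP; right.
have -> : - x - s = - (x - s) - 2 * s by ring.
by rewrite rpredB // rpredN.
Qed.

Lemma sGammaD x y : x \in sGamma -> y \in sGamma -> x + y \in sGamma.
Proof.
move=> xS yS; have [xG|xG] := boolP (x \in Gamma).
  have [yG|yG] := boolP (y \in Gamma).
    by apply: Gamma_sGamma; apply: rpredD.
  by apply: coset_sGamma; apply: Gamma_cosetD => //; apply: sGamma_coset.
have xs := sGamma_coset xS xG; have [yG|yG] := boolP (y \in Gamma).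
  by apply: coset_sGamma; rewrite [x + y]addrC; apply: Gamma_cosetD.
by apply: Gamma_sGamma; apply: coset_cosetD => //; apply: sGamma_coset.
Qed.

Lemma GammaD x y : x \in sGamma -> y \in sGamma ->
  (x + y \in Gamma) = ((x \in Gamma) == (y \in Gamma)).
Proof.
move=> xS yS; have [xG|xG] := boolP (x \in Gamma); first by rewrite rpredDl.
have xs := sGamma_coset xS xG; have [yG|yG] := boolP (y \in Gamma).
  by rewrite rpredDr // (negPf xG).
by rewrite coset_cosetD // sGamma_coset.
Qed.

(** The structure constants in the uniform basis E_w, G_w, c: [coefEE] covers
    the brackets LL, LT, TL and TT at once.  The cocycles are only evaluated on
    pairs of sum 0, hence on two indices in the same coset, so that they may be
    functions of the first index alone. *)
Definition coefEE (x y : F) : F :=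
  if x \in Gamma then (if y \in Gamma then x - y else - y)
  else (if y \in Gamma then x else 0).
Definition cocycleE (x : F) : F :=
  if x \in Gamma then (x ^+ 3 - x) / 12 else x / 3.
Definition coefEG (x u : F) : F := if x \in Gamma then x / 2 - u else 1.
Definition coefGG (u v : F) : F :=
  if u \in Gamma then (if v \in Gamma then 2 else v - u)
  else (if v \in Gamma then u - v else - 2).
Definition cocycleG (u : F) : F :=
  (if u \in Gamma then 1 else -1) * ((u ^+ 2 - 4^-1) / 3).

Lemma addr_eq0_Gamma x y : x + y = 0 ->
  (x \in Gamma) = (y \in Gamma).
Proof. by move/eqP; rewrite addr_eq0 => /eqP ->; rewrite rpredN. Qed.

Lemma mem_sGamma0 : 0 \in sGamma.
Proof. by apply: Gamma_sGamma; apply: rpred0. Qed.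

Lemma mem_sGamma_s : s \in sGamma.
Proof. by apply: coset_sGamma; rewrite subrr rpred0. Qed.

Lemma s_neq0 : s != 0.
Proof. by apply: contra s_notin => /eqP ->; apply: rpred0. Qed.

End IndexGroup.

(** * Indexing the basis by sGamma *)

Section BasisIndex.

Variables (F : fieldType).
Variables (Gamma : zmodClosed F) (s : F).
Hypothesis s_notin : s \notin Gamma.

Local Notation B := (basis Gamma s).
Local Notation sGamma := (in_sGamma Gamma s).

(** The indices of E_w and of G_w; the default value [BasisC] is taken only for
    w outside sGamma. *)
Definition eidx (w : F) : B :=
  if insub w is Some x then BasisL x
  else if insub w is Some x then BasisT x else BasisC.

Definition gidx (w : F) : B :=
  if insub w is Some u then BasisG u else BasisC.

Definition weight (b : B) : F :=
  match b with
  | BasisL x => val x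
  | BasisT x => val x
  | BasisG u => val u
  | BasisC => 0
  end.

Lemma eidxL (x : subgroup Gamma) : eidx (val x) = BasisL x.
Proof. by rewrite /eidx valK. Qed.

Lemma eidxT (x : {mu : F | in_coset Gamma s mu}) : eidx (val x) = BasisT x.
Proof.
by rewrite /eidx valK insubN //; apply: (coset_notin s_notin); apply: (valP x).
Qed.

Lemma gidxG (u : {u : F | in_sGamma Gamma s u}) : gidx (val u) = BasisG u.
Proof. by rewrite /gidx valK. Qed.

Lemma basis_cases (P : B -> Prop) :
    (forall w, w \in sGamma -> P (eidx w)) ->
    (forall w, w \in sGamma -> P (gidx w)) -> P BasisC ->
  forall b, P b.
Proof.
move=> PE PG PC [x|x|u|] //.
- by rewrite -eidxL; apply/PE/Gamma_sGamma/valP.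
- by rewrite -eidxT; apply/PE/coset_sGamma/(valP x).
- by rewrite -gidxG; apply/PG/(valP u).
Qed.

Variant sGamma_spec (w : F) : bool -> B -> Prop :=
  | SGammaL (x : subgroup Gamma) of w = val x :
      sGamma_spec w true (BasisL x)
  | SGammaT (x : {mu : F | in_coset Gamma s mu}) of w = val x :
      sGamma_spec w false (BasisT x).

Lemma sGammaP w : w \in sGamma -> sGamma_spec w (w \in Gamma) (eidx w).
Proof.
move=> wS; have [wG|wG] := boolP (w \in Gamma).
  by rewrite -[w in eidx w](SubK (subgroup Gamma) wG) eidxL; constructor.
have ws : in_coset Gamma s w := sGamma_coset wS wG.
rewrite -[w in eidx w](SubK {mu : F | in_coset Gamma s mu} ws) eidxT.
by constructor.
Qed.

Lemma weight_eidx w : w \in sGamma -> weight (eidx w) = w.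
Proof. by case/sGammaP. Qed.

Lemma weight_gidx w : w \in sGamma -> weight (gidx w) = w.
Proof. by move=> wS; rewrite /gidx (insubT (in_sGamma Gamma s) wS). Qed.

Lemma parity_eidx w : parity (eidx w) = false.
Proof. by rewrite /eidx; case: insub => //; case: insub. Qed.

Lemma parity_gidx w : w \in sGamma -> parity (gidx w) = true.
Proof. by move=> wS; rewrite /gidx (insubT (in_sGamma Gamma s) wS). Qed.

Lemma eidx_eq x y : x \in sGamma -> y \in sGamma ->
  (eidx x == eidx y) = (x == y).
Proof.
move=> xS yS; apply/eqP/eqP => [/(congr1 weight)|->] //.
by rewrite !weight_eidx.
Qed.

Lemma gidx_eq x y : x \in sGamma -> y \in sGamma ->
  (gidx x == gidx y) = (x == y).
Proof.
move=> xS yS; apply/eqP/eqP => [/(congr1 weight)|->] //.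
by rewrite !weight_gidx.
Qed.

Lemma egidx_eq x y : y \in sGamma -> (eidx x == gidx y) = false.
Proof.
move=> yS; apply/eqP => /(congr1 (@parity _ _ _)).
by rewrite parity_eidx parity_gidx.
Qed.

Lemma eidxC x : x \in sGamma -> (eidx x == BasisC) = false.
Proof. by case/sGammaP => y _; apply/eqP. Qed.

Lemma gidxC x : x \in sGamma -> (gidx x == BasisC) = false.
Proof.
move=> xS; apply/eqP => /(congr1 (@parity _ _ _)).
by rewrite parity_gidx.
Qed.

End BasisIndex.

(** * Consequences of the bracket relations *)

(** The relations are stated for an arbitrary bilinear bracket on an arbitrary
    space V: the computations below use nothing else about the algebra.  Even
    linear independence enters only where two expansions are compared. *)
Record N2_relations (F : fieldType) (Gamma : zmodClosed F) (s : F)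
    (V : lmodType F) (br : V -> V -> V) (E G : F -> V) (C : V) : Prop := {
  N2_linl : forall y, linear (br^~ y);
  N2_linr : forall x, linear (br x);
  N2_Cl : forall x, br C x = 0;
  N2_Cr : forall x, br x C = 0;
  N2_EE : {in in_sGamma Gamma s &, forall x y,
    br (E x) (E y) = coefEE Gamma x y *: E (x + y)
                     + (cocycleE Gamma x * (x + y == 0)%:R) *: C};
  N2_EG : {in in_sGamma Gamma s &, forall x u,
    br (E x) (G u) = coefEG Gamma x u *: G (x + u)};
  N2_GE : {in in_sGamma Gamma s &, forall u x,
    br (G u) (E x) = - coefEG Gamma x u *: G (u + x)};
  N2_GG : {in in_sGamma Gamma s &, forall u v,
    br (G u) (G v) = coefGG Gamma u v *: E (u + v)
                     + (cocycleG Gamma u * (u + v == 0)%:R) *: C}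
}.

Section Relations.

Variables (F : fieldType) (charF0 : [pchar F] =i pred0).
Variables (Gamma : zmodClosed F) (s : F).
Hypotheses (s_notin : s \notin Gamma) (s2_in : 2 * s \in Gamma).

Local Notation sGamma := (in_sGamma Gamma s).

Variables (V : lmodType F) (br : V -> V -> V) (E G : F -> V) (C : V).
Hypothesis rel : N2_relations Gamma s br E G C.

Let br_linl := N2_linl rel.
Let br_linr := N2_linr rel.
Let brCl := N2_Cl rel.
Let brCr := N2_Cr rel.
Let brEE := N2_EE rel.
Let brEG := N2_EG rel.
Let brGE := N2_GE rel.
Let brGG := N2_GG rel.

Let S0 : 0 \in sGamma := mem_sGamma0 Gamma s.
Let sS : s \in sGamma := mem_sGamma_s Gamma s.
Let s0 : s != 0 := s_neq0 s_notin.
Let sN : (s \in Gamma) = false := negPf s_notin.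

Let brDl x y z : br (x + y) z = br x z + br y z.
Proof. exact: linD (br_linl z) x y. Qed.
Let brDr x y z : br x (y + z) = br x y + br x z.
Proof. exact: linD (br_linr x) y z. Qed.
Let brZl a x y : br (a *: x) y = a *: br x y.
Proof. exact: linZ (br_linl y) a x. Qed.
Let brZr a x y : br x (a *: y) = a *: br x y.
Proof. exact: linZ (br_linr x) a y. Qed.

Lemma natF_neq0 n : n.+1%:R != 0 :> F.
Proof. by rewrite (proj1 (pcharf0P F) charF0). Qed.

Let brEs := (brEE, brEG, brGE, brGG).
Let brL := (brDl, brDr, brZl, brZr, brCl, brCr, scaler0, addr0).

Definition super_jacobi p q (x y z : V) :=
  br x (br y z) = br (br x y) z + (-1) ^+ (p && q) *: br y (br x z).

(** The Jacobi identity for three basis vectors compares multiples of a single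
    basis vector e, of weight the sum of the indices, and of c. *)
Lemma jacobi_comb (e c : V) a a1 a2 b b1 b2 t d d1 d2 :
    a * a1 = b * b1 + t * (d * d1) -> a * a2 = b * b2 + t * (d * d2) ->
  a *: (a1 *: e + a2 *: c)
  = b *: (b1 *: e + b2 *: c) + t *: (d *: (d1 *: e + d2 *: c)).
Proof.
move=> h1 h2; rewrite !scalerDr !scalerA h1 h2 !scalerDl -!addrA.
by congr (_ + _); rewrite mulrA addrCA mulrA.
Qed.

Lemma jacobi_combG (g : V) a a1 b b1 t d d1 :
    a * a1 = b * b1 + t * (d * d1) ->
  a *: (a1 *: g) = b *: (b1 *: g) + t *: (d *: (d1 *: g)).
Proof. by move=> h1; rewrite !scalerA h1 !scalerDl !mulrA. Qed.

(* The coefficient of e is compared in each of the eight distributions of the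
   indices among the two cosets.  For the coefficient of c only the case
   x = - (y + z) matters, and then the cosets of y and z determine that of x. *)
Ltac jacobi_coefs := rewrite /coefEE /coefEG /coefGG /cocycleE /cocycleG.

Ltac jacobi x y z xS yS zS :=
  have xyS := sGammaD s2_in xS yS; have xzS := sGammaD s2_in xS zS;
  have yzS := sGammaD s2_in yS zS;
  rewrite /super_jacobi /= ?expr0 ?expr1 !brEs // !brL !brEs //;
  rewrite -!addrA [y + (x + z)]addrCA;
  (apply: jacobi_comb || apply: jacobi_combG);
  [ jacobi_coefs; rewrite !(GammaD s2_in) //;
    case: (x \in Gamma); case: (y \in Gamma); case: (z \in Gamma) => /=;
    field; rewrite ?natF_neq0 //
  | have [/eqP|_] := eqVneq (x + (y + z)) 0;
    [ rewrite addr_eq0 => /eqP ->; jacobi_coefs;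
      rewrite !(rpredN, GammaD s2_in) ?(sGammaN s2_in) //;
      case: (y \in Gamma); case: (z \in Gamma) => /=;
      field; rewrite ?natF_neq0 //
    | by rewrite !mulr0 addr0 ] ..].

Lemma jacobiEEE x y z : x \in sGamma -> y \in sGamma -> z \in sGamma ->
  super_jacobi false false (E x) (E y) (E z).
Proof. by move=> xS yS zS; jacobi x y z xS yS zS. Qed.

Lemma jacobiEEG x y z : x \in sGamma -> y \in sGamma -> z \in sGamma ->
  super_jacobi false false (E x) (E y) (G z).
Proof. by move=> xS yS zS; jacobi x y z xS yS zS. Qed.

Lemma jacobiEGE x y z : x \in sGamma -> y \in sGamma -> z \in sGamma ->
  super_jacobi false true (E x) (G y) (E z).
Proof. by move=> xS yS zS; jacobi x y z xS yS zS. Qed.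

Lemma jacobiEGG x y z : x \in sGamma -> y \in sGamma -> z \in sGamma ->
  super_jacobi false true (E x) (G y) (G z).
Proof. by move=> xS yS zS; jacobi x y z xS yS zS. Qed.

Lemma jacobiGEE x y z : x \in sGamma -> y \in sGamma -> z \in sGamma ->
  super_jacobi true false (G x) (E y) (E z).
Proof. by move=> xS yS zS; jacobi x y z xS yS zS. Qed.

Lemma jacobiGEG x y z : x \in sGamma -> y \in sGamma -> z \in sGamma ->
  super_jacobi true false (G x) (E y) (G z).
Proof. by move=> xS yS zS; jacobi x y z xS yS zS. Qed.

Lemma jacobiGGE x y z : x \in sGamma -> y \in sGamma -> z \in sGamma ->
  super_jacobi true true (G x) (G y) (E z).
Proof. by move=> xS yS zS; jacobi x y z xS yS zS. Qed.

Lemma jacobiGGG x y z : x \in sGamma -> y \in sGamma -> z \in sGamma ->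
  super_jacobi true true (G x) (G y) (G z).
Proof. by move=> xS yS zS; jacobi x y z xS yS zS. Qed.

Let br0l y : br 0 y = 0. Proof. exact: lin0 (br_linl y). Qed.
Let br0r x : br x 0 = 0. Proof. exact: lin0 (br_linr x). Qed.

Lemma jacobiCl p q y z : super_jacobi p q C y z.
Proof. by rewrite /super_jacobi !brCl br0l br0r scaler0 addr0. Qed.

Lemma jacobiCm p q x z : super_jacobi p q x C z.
Proof. by rewrite /super_jacobi !brCl !brCr br0l br0r scaler0 addr0. Qed.

Lemma jacobiCr p q x y : super_jacobi p q x y C.
Proof. by rewrite /super_jacobi !brCr !br0r scaler0 addr0. Qed.

Lemma adE0E w : w \in sGamma -> br (E 0) (E w) = - w *: E w.
Proof.
move=> wS; rewrite brEE ?mem_sGamma0 // /coefEE /cocycleE rpred0 !add0r.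
by rewrite expr0n subrr !mul0r scale0r addr0 if_same.
Qed.

Lemma adE0G w : w \in sGamma -> br (E 0) (G w) = - w *: G w.
Proof.
by move=> wS; rewrite brEG ?mem_sGamma0 // /coefEG rpred0 mul0r !add0r.
Qed.

Lemma brEE0 w : w \in sGamma -> br (E w) (E 0) = w *: E w.
Proof.
move=> wS; rewrite brEE ?mem_sGamma0 // /coefEE rpred0 subr0 addr0 if_same.
have [->|_] := eqVneq w 0; last by rewrite mulr0 scale0r addr0.
by rewrite /cocycleE rpred0 expr0n subrr !mul0r !scale0r addr0.
Qed.

Lemma brGE0 w : w \in sGamma -> br (G w) (E 0) = w *: G w.
Proof.
move=> wS; rewrite brGE ?mem_sGamma0 // /coefEG rpred0 mul0r sub0r.
by rewrite opprK addr0.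
Qed.

(** A map that scales the weight spaces by an additive function psi of the weight
    is a derivation: brackets add weights, and c has weight 0. *)
Section Diagonal.

Variables (D : V -> V) (psi : F -> F).
Hypothesis D_lin : linear D.
Hypothesis psiD : forall x y, x \in sGamma -> y \in sGamma ->
  psi (x + y) = psi x + psi y.
Hypothesis DE : forall w, w \in sGamma -> D (E w) = psi w *: E w.
Hypothesis DG : forall w, w \in sGamma -> D (G w) = psi w *: G w.
Hypothesis DC : D C = 0.

Let psi0 : psi 0 = 0.
Proof.
have := psiD S0 S0; rewrite addr0 => /eqP.
by rewrite -subr_eq0 opprD addNKr oppr_eq0 => /eqP.
Qed.

Let psi_central x y : x \in sGamma -> y \in sGamma ->
  (psi x + psi y) * (x + y == 0)%:R = 0.
Proof.
move=> xS yS; rewrite -psiD //; have [->|_] := eqVneq (x + y) 0.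
  by rewrite psi0 mul0r.
by rewrite mulr0.
Qed.

Lemma diag_derEE x y : x \in sGamma -> y \in sGamma ->
  D (br (E x) (E y)) = br (D (E x)) (E y) + br (E x) (D (E y)).
Proof.
move=> xS yS; rewrite !DE // brZl brZr -scalerDl brEE //.
rewrite (linD D_lin) !(linZ D_lin) DC scaler0 addr0 DE ?sGammaD // psiD //.
by rewrite scalerDr !scalerA mulrCA psi_central // mulr0 scale0r addr0 mulrC.
Qed.

Lemma diag_derEG x u : x \in sGamma -> u \in sGamma ->
  D (br (E x) (G u)) = br (D (E x)) (G u) + br (E x) (D (G u)).
Proof.
move=> xS uS; rewrite DE // DG // brZl brZr -scalerDl brEG //.
by rewrite (linZ D_lin) DG ?sGammaD // psiD // !scalerA mulrC.
Qed.

Lemma diag_derGE u x : u \in sGamma -> x \in sGamma ->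
  D (br (G u) (E x)) = br (D (G u)) (E x) + br (G u) (D (E x)).
Proof.
move=> uS xS; rewrite DE // DG // brZl brZr -scalerDl brGE //.
by rewrite (linZ D_lin) DG ?sGammaD // psiD // !scalerA mulrC.
Qed.

Lemma diag_derGG u v : u \in sGamma -> v \in sGamma ->
  D (br (G u) (G v)) = br (D (G u)) (G v) + br (G u) (D (G v)).
Proof.
move=> uS vS; rewrite !DG // brZl brZr -scalerDl brGG //.
rewrite (linD D_lin) !(linZ D_lin) DC scaler0 addr0 DE ?sGammaD // psiD //.
by rewrite scalerDr !scalerA mulrCA psi_central // mulr0 scale0r addr0 mulrC.
Qed.

Lemma diag_derC y : D (br C y) = br (D C) y + br C (D y).
Proof. by rewrite DC !brCl br0l (lin0 D_lin) addr0. Qed.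

Lemma diag_derCr y : D (br y C) = br (D y) C + br y (D C).
Proof. by rewrite DC !brCr br0r (lin0 D_lin) addr0. Qed.

End Diagonal.

Hypothesis indepE : forall w a b, w \in sGamma ->
  a *: E w + b *: C = 0 -> a = 0 /\ b = 0.
Hypothesis indepG : forall w a, w \in sGamma -> a *: G w = 0 -> a = 0.

Let eqE w a b a' b' : w \in sGamma ->
  a *: E w + b *: C = a' *: E w + b' *: C -> a = a' /\ b = b'.
Proof.
move=> wS /eqP; rewrite -subr_eq0 opprD addrACA -!scalerBl => /eqP.
by case/(indepE wS) => /eqP; rewrite subr_eq0 => /eqP -> /eqP;
  rewrite subr_eq0 => /eqP ->.
Qed.

Let eqG w a a' : w \in sGamma -> a *: G w = a' *: G w -> a = a'.
Proof.
move=> wS /eqP; rewrite -subr_eq0 -scalerBl => /eqP /(indepG wS) /eqP.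
by rewrite subr_eq0 => /eqP.
Qed.

(** The bracket with T_s detects the components along L_0 and G_0 of an element
    of weight 0, because s is nonzero. *)
Lemma weight0_Es (a b c : F) : br (a *: E 0 + b *: G 0 + c *: C) (E s)
  = - (a * s) *: E s + (- b) *: G s.
Proof.
rewrite !brDl !brZl brCl scaler0 addr0 brEE // brGE // add0r.
rewrite (negPf s0) mulr0 scale0r addr0 !scalerA.
by rewrite /coefEE /coefEG rpred0 sN !mulrN mulr1.
Qed.

Lemma weight0_G0 (a b c : F) :
  br (a *: E 0 + b *: G 0 + c *: C) (G 0) = 0 -> b = 0.
Proof.
rewrite !brDl !brZl brCl scaler0 addr0 brEG // brGG // addr0.
rewrite /coefEG /coefGG rpred0 mul0r subr0 scale0r scaler0 add0r.
rewrite scalerDr !scalerA => /(indepE S0)[/eqP + _].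
by rewrite mulf_eq0 (negPf (natF_neq0 1)) orbF => /eqP.
Qed.

(** * Even derivations that preserve weights *)

Section EvenWeightPreserving.

Variables (d : V -> V) (f h : F -> F) (b e e' : F).
Hypothesis d_lin : linear d.
Hypothesis dE : forall w, w \in sGamma ->
  d (E w) = f w *: E w + (b * (w == 0)%:R) *: C.
Hypothesis dG : forall w, w \in sGamma -> d (G w) = h w *: G w.
Hypothesis dC : d C = e' *: E 0 + e *: C.
Hypothesis dCE : d (br C (E s)) = br (d C) (E s) + br C (d (E s)).
Hypothesis dEG : forall x u, x \in sGamma -> u \in sGamma ->
  d (br (E x) (G u)) = br (d (E x)) (G u) + br (E x) (d (G u)).
Hypothesis dGG : forall u v, u \in sGamma -> v \in sGamma ->
  d (br (G u) (G v)) = br (d (G u)) (G v) + br (G u) (d (G v)).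
Hypothesis f0 : f 0 = 0.

Let e'0 : e' = 0.
Proof.
have: d (br C (E s)) = br (d C) (E s) + br C (d (E s)) by [].
rewrite !brCl (lin0 d_lin) dC addr0 brDl !brZl brCl scaler0 addr0 brEE //.
rewrite add0r (negPf s0) mulr0 scale0r addr0 scalerA.
rewrite /coefEE rpred0 sN => /esym e1.
have [|/eqP] := @indepE s (e' * - s) 0 sS; first by rewrite scale0r addr0.
by rewrite mulrN oppr_eq0 mulf_eq0 (negPf s0) orbF => /eqP.
Qed.

(* from [T_x, G_u] = G_(x + u) *)
Let h_coset x u : x \in sGamma -> x \notin Gamma -> u \in sGamma ->
  h (x + u) = f x + h u.
Proof.
move=> xS xN uS; have xuS := sGammaD s2_in xS uS.
have := dEG xS uS; rewrite dE // dG // brDl !brZl brZr brCl scaler0 addr0.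
rewrite brEG // (linZ d_lin) dG // -scalerDl scalerA /coefEG (negPf xN).
by rewrite mul1r scale1r; apply: eqG.
Qed.

Let h_GG u v : u \in sGamma -> v \in sGamma ->
  coefGG Gamma u v * f (u + v) = (h u + h v) * coefGG Gamma u v /\
  coefGG Gamma u v * (b * (u + v == 0)%:R)
    + cocycleG Gamma u * (u + v == 0)%:R * e
  = (h u + h v) * (cocycleG Gamma u * (u + v == 0)%:R).
Proof.
move=> uS vS; have uvS := sGammaD s2_in uS vS.
have := dGG uS vS; rewrite !dG // brZl brZr -scalerDl brGG //.
rewrite (linD d_lin) !(linZ d_lin) dE // dC e'0 scale0r add0r.
rewrite !scalerDr !scalerA -addrA -scalerDl; exact: eqE.
Qed.

Let n2 : 2 != 0 :> F := natF_neq0 1.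

Let fh_Gamma u : u \in Gamma -> f u = h u + h 0.
Proof.
move=> uG; have [] := h_GG (Gamma_sGamma s uG) S0.
rewrite /coefGG uG rpred0 addr0 [2 * _]mulrC => e1 _.
exact: (mulIf n2).
Qed.

Let h0 : h 0 = 0.
Proof.
have := fh_Gamma (rpred0 _); rewrite f0 -mulr2n -mulr_natr => /esym/eqP.
by rewrite mulf_eq0 (negPf n2) orbF => /eqP.
Qed.

Lemma even_eq w : w \in sGamma -> f w = h w.
Proof.
move=> wS; have [wG|wN] := boolP (w \in Gamma).
  by rewrite fh_Gamma // h0 addr0.
by have := h_coset wS wN S0; rewrite h0 !addr0.
Qed.

Let h_cosetD x u : x \in sGamma -> x \notin Gamma -> u \in sGamma ->
  h (x + u) = h x + h u.
Proof. by move=> xS xN uS; rewrite h_coset // even_eq. Qed.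

(** The rule h(x + u) = h(x) + h(u) is first known for x in Gamma_s only.  For
    x, y in Gamma it follows by writing x + y = (s + x) + (- s + y). *)
Lemma even_additive x y : x \in sGamma -> y \in sGamma ->
  h (x + y) = h x + h y.
Proof.
move=> xS yS; have [xG|xN] := boolP (x \in Gamma); last exact: h_cosetD.
have [yG|yN] := boolP (y \in Gamma); last first.
  by rewrite addrC h_cosetD // addrC.
have NsS := sGammaN s2_in sS.
have NsN : - s \notin Gamma by rewrite rpredN.
have xsS := sGammaD s2_in sS xS; have ysS := sGammaD s2_in NsS yS.
have xsN : s + x \notin Gamma by rewrite (GammaD s2_in) // xG sN.
have -> : x + y = (s + x) + (- s + y) by rewrite addrACA subrr add0r.
rewrite h_cosetD // h_cosetD // (h_cosetD NsS) // addrACA -(h_cosetD sS) //.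
by rewrite subrr h0 add0r.
Qed.

(* the coefficient of c in the image of [G_u, G_(- u)] *)
Let be_rel u : u \in Gamma -> 2 * b + (u ^+ 2 - 4^-1) / 3 * e = 0.
Proof.
move=> uG; have NuG : - u \in Gamma by rewrite rpredN.
have [_] := h_GG (Gamma_sGamma s uG) (Gamma_sGamma s NuG).
rewrite -even_additive ?Gamma_sGamma // subrr h0 eqxx !mulr1 mul0r.
by rewrite /coefGG /cocycleG uG NuG mul1r.
Qed.

Lemma even_central : e = 0 /\ b = 0.
Proof.
(* 0 and 2 s are two elements of Gamma with distinct cocycle values *)
have r0 := be_rel (rpred0 _); have r2 := be_rel s2_in.
have e0 : e = 0.
  have n3 := natF_neq0 2; have n4 := natF_neq0 3.
  have : 4 * s ^+ 2 / 3 * e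
      = (2 * b + ((2 * s) ^+ 2 - 4^-1) / 3 * e)
        - (2 * b + (0 ^+ 2 - 4^-1) / 3 * e) by field; rewrite n3 n4.
  rewrite r0 r2 subrr => /eqP; rewrite expr2 !mulf_eq0 invr_eq0.
  by rewrite (negPf n3) (negPf n4) (negPf s0) /= => /eqP.
split=> //; move: r0; rewrite e0 mulr0 addr0 => /eqP.
by rewrite mulf_eq0 (negPf n2) => /eqP.
Qed.

Lemma even_eigen :
  [/\ forall w, w \in sGamma -> d (E w) = h w *: E w,
      forall w, w \in sGamma -> d (G w) = h w *: G w,
      d C = 0
    & forall x y, x \in sGamma -> y \in sGamma -> h (x + y) = h x + h y].
Proof.
have [e0 b0] := even_central; split=> [w wS|||].
- by rewrite dE // even_eq // b0 mul0r scale0r addr0.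
- exact: dG.
- by rewrite dC e'0 e0 !scale0r addr0.
- exact: even_additive.
Qed.

End EvenWeightPreserving.

(** * Odd derivations that preserve weights *)

(** An odd derivation that kills T_s and preserves weights is zero. *)
Section OddWeightPreserving.

Variables (d : V -> V) (f h : F -> F) (b e : F).
Hypothesis d_lin : linear d.
Hypothesis dE : forall w, w \in sGamma -> d (E w) = f w *: G w.
Hypothesis dG : forall w, w \in sGamma ->
  d (G w) = h w *: E w + (b * (w == 0)%:R) *: C.
Hypothesis dC : d C = e *: G 0.
Hypothesis dCE : d (br C (E s)) = br (d C) (E s) + br C (d (E s)).
Hypothesis dEE : forall x y, x \in sGamma -> y \in sGamma ->
  d (br (E x) (E y)) = br (d (E x)) (E y) + br (E x) (d (E y)).
Hypothesis dEG : forall x u, x \in sGamma -> u \in sGamma ->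
  d (br (E x) (G u)) = br (d (E x)) (G u) + br (E x) (d (G u)).
Hypothesis fs : f s = 0.

Let e0 : e = 0.
Proof.
have: d (br C (E s)) = br (d C) (E s) + br C (d (E s)) by [].
rewrite !brCl (lin0 d_lin) dC addr0 brZl brGE // add0r scalerA.
rewrite /coefEG sN mulrN1 => /esym /(indepG sS) /eqP.
by rewrite oppr_eq0 => /eqP.
Qed.

(* from the image of [E_x, T_s]: for x in Gamma_s this bracket is central, and
   for x in Gamma it relates f(x) to f on Gamma_s *)
Let f_EE x : x \in sGamma -> coefEE Gamma x s * f (x + s) = - f x.
Proof.
move=> xS; have xsS := sGammaD s2_in xS sS.
have := dEE xS sS; rewrite !dE // fs scale0r br0r addr0 brZl brGE // brEE //.
rewrite (linD d_lin) !(linZ d_lin) dE // dC e0 scale0r scaler0 addr0 !scalerA.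
rewrite /coefEG sN mulrN1; exact: eqG.
Qed.

Let f0 w : w \in sGamma -> f w = 0.
Proof.
have f_coset x : x \in sGamma -> x \notin Gamma -> f x = 0.
  move=> xS xN; have /esym/eqP := f_EE xS.
  by rewrite /coefEE (negPf xN) sN mul0r oppr_eq0 => /eqP.
move=> wS; have [wG|wN] := boolP (w \in Gamma); last exact: f_coset.
have /esym/eqP := f_EE wS; rewrite (f_coset (w + s)) ?sGammaD //.
  by rewrite mulr0 oppr_eq0 => /eqP.
by rewrite (GammaD s2_in) // wG sN.
Qed.

(* from [T_s, G_u] = G_(s + u); since u = (- s) + x, this reaches every G_x *)
Let h_EG u : u \in sGamma -> h (s + u) = h u * coefEE Gamma s u /\
   b * (s + u == 0)%:R = h u * (cocycleE Gamma s * (s + u == 0)%:R).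
Proof.
move=> uS; have suS := sGammaD s2_in sS uS.
have := dEG sS uS; rewrite dE // f0 // scale0r br0l add0r dG // brDr !brZr.
rewrite brCr scaler0 addr0 brEG // brEE // (linZ d_lin) dG //.
rewrite /coefEG sN scale1r.
rewrite scalerDr !scalerA; exact: eqE.
Qed.

Let h0 w : w \in sGamma -> h w = 0.
Proof.
have NsS := sGammaN s2_in sS.
have h_Gamma x : x \in Gamma -> h x = 0.
  move=> xG; have xS := Gamma_sGamma s xG.
  have xsS := sGammaD s2_in NsS xS.
  have [] := h_EG xsS; rewrite addNKr => -> _.
  by rewrite /coefEE sN (GammaD s2_in) // rpredN sN xG mulr0.
move=> wS; have [wG|wN] := boolP (w \in Gamma); first exact: h_Gamma.
have xsS := sGammaD s2_in NsS wS.
have [] := h_EG xsS; rewrite addNKr => -> _; rewrite h_Gamma ?mul0r //.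
by rewrite (GammaD s2_in) // rpredN sN (negPf wN).
Qed.

Lemma odd_vanish :
  [/\ forall w, w \in sGamma -> d (E w) = 0,
      forall w, w \in sGamma -> d (G w) = 0 & d C = 0].
Proof.
have NsS := sGammaN s2_in sS.
have b0 : b = 0.
  by have [_] := h_EG NsS; rewrite subrr eqxx !mulr1 h0 // mul0r.
split=> [w wS|w wS|]; last by rewrite dC e0 scale0r.
  by rewrite dE // f0 // scale0r.
by rewrite dG // h0 // b0 mul0r !scale0r addr0.
Qed.

End OddWeightPreserving.

(** As ad G_0 sends T_mu to - G_mu, the choice a = - f(s) makes d - a ad G_0 kill
    T_s. *)
Lemma odd_inner (d : V -> V) (f h : F -> F) (b e : F) :
    linear d ->
    (forall w, w \in sGamma -> d (E w) = f w *: G w) ->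
    (forall w, w \in sGamma ->
       d (G w) = h w *: E w + (b * (w == 0)%:R) *: C) ->
    d C = e *: G 0 ->
    d (br C (E s)) = br (d C) (E s) + br C (d (E s)) ->
    (forall x y, x \in sGamma -> y \in sGamma ->
       d (br (E x) (E y)) = br (d (E x)) (E y) + br (E x) (d (E y))) ->
    (forall x u, x \in sGamma -> u \in sGamma ->
       d (br (E x) (G u)) = br (d (E x)) (G u) + br (E x) (d (G u))) ->
  exists a, [/\ forall w, w \in sGamma -> d (E w) = br (a *: G 0) (E w),
      forall w, w \in sGamma -> d (G w) = br (a *: G 0) (G w)
    & d C = br (a *: G 0) C].
Proof.
move=> d_lin dE dG dC dCE dEE dEG; pose a := - f s; exists a.
pose d1 x := d x - br (a *: G 0) x.
have jac y z : super_jacobi true false (G 0) y z ->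
    d (br y z) = br (d y) z + br y (d z) ->
  d1 (br y z) = br (d1 y) z + br y (d1 z).
  rewrite /super_jacobi /= scale1r /d1 => j ->.
  rewrite (linB (br_linl z)) (linB (br_linr y)) !brZl j brZr scalerDr.
  by rewrite opprD addrACA.
have [||||||||d1E d1G d1C] := @odd_vanish d1
  (fun w => f w + a * coefEG Gamma w 0) (fun w => h w - a * coefGG Gamma 0 w)
  (b - a * cocycleG Gamma 0) e.
- move=> c x y; rewrite /d1 d_lin (br_linr _ c x y) scalerBr opprD.
  by rewrite addrACA.
- move=> w wS; rewrite /d1 dE // brZl brGE // add0r scalerA mulrN scaleNr.
  by rewrite opprK scalerDl.
- move=> w wS; rewrite /d1 dG // brZl brGG // add0r scalerDr !scalerA.
  by rewrite opprD addrACA -!scalerBl !mulrBl !mulrA.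
- by rewrite /d1 dC brCr subr0.
- by apply: jac => //; apply: jacobiCm.
- by move=> x y xS yS; apply: jac; [apply: jacobiGEE | apply: dEE].
- by move=> x u xS uS; apply: jac; [apply: jacobiGEG | apply: dEG].
- by rewrite /coefEG sN mulr1 /a addrN.
split=> [w wS|w wS|]; apply/eqP; rewrite -subr_eq0.
- by rewrite -/(d1 _) d1E.
- by rewrite -/(d1 _) d1G.
- by rewrite -/(d1 _) d1C.
Qed.

End Relations.

(** * Extending homomorphisms from Gamma to sGamma *)

Section HomExt.

Variables (F : fieldType) (charF0 : [pchar F] =i pred0).
Variables (Gamma : zmodClosed F) (s : F).
Hypotheses (s_notin : s \notin Gamma) (s2_in : 2 * s \in Gamma).

Local Notation sGamma := (in_sGamma Gamma s).

Definition hom_ext (phi : {additive subgroup Gamma -> F}) (w : F) : F :=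
  if w \in Gamma then hom_val phi w else hom_val phi (2 * w) / 2.

Lemma hom_valE (phi : {additive subgroup Gamma -> F}) x (xG : x \in Gamma) :
  hom_val phi x = phi (Sub x xG).
Proof. by rewrite /hom_val (insubT (fun z => z \in Gamma) xG). Qed.

Lemma hom_val_val (phi : {additive subgroup Gamma -> F}) (x : subgroup Gamma) :
  hom_val phi (val x) = phi x.
Proof. by rewrite /hom_val valK. Qed.

Lemma hom_valD (phi : {additive subgroup Gamma -> F}) :
  {in Gamma &, {morph hom_val phi : x y / x + y}}.
Proof.
move=> x y xG yG; have xyG := rpredD xG yG.
rewrite (hom_valE _ xG) (hom_valE _ yG) (hom_valE _ xyG) -raddfD.
by congr (phi _); apply: val_inj; rewrite raddfD.
Qed.

Lemma hom_val_fun (phi : {additive subgroup Gamma -> F}) (f : F -> F) x :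
  (forall y, phi y = f (val y)) -> x \in Gamma -> hom_val phi x = f x.
Proof. by move=> phi_f xG; rewrite (hom_valE _ xG) phi_f SubK. Qed.

Lemma double_sGamma w : w \in sGamma -> 2 * w \in Gamma.
Proof.
move=> wS; have -> : 2 * w = w + w by rewrite -mulr2n mulr_natl.
by rewrite (GammaD s2_in) ?eqxx.
Qed.

(** On Gamma too, phi(w) is half of phi(2 w); with this single formula for both
    cosets additivity on sGamma is immediate. *)
Lemma hom_ext_half phi w : w \in sGamma ->
  hom_ext phi w = hom_val phi (2 * w) / 2.
Proof.
rewrite /hom_ext; case: ifP => // wG _.
have -> : 2 * w = w + w by rewrite -mulr2n mulr_natl.
rewrite hom_valD // -mulr2n -[_ *+ 2]mulr_natr mulfK //.
exact: (natF_neq0 charF0 1).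
Qed.

Lemma hom_extD phi : {in sGamma &, {morph hom_ext phi : x y / x + y}}.
Proof.
move=> x y xS yS; have xyS := sGammaD s2_in xS yS.
by rewrite !hom_ext_half // mulrDr hom_valD ?double_sGamma // mulrDl.
Qed.

Lemma hom_ext_fun (phi : {additive subgroup Gamma -> F}) (f : F -> F) w :
    (forall y, phi y = f (val y)) -> f (2 * w) = 2 * f w -> w \in sGamma ->
  hom_ext phi w = f w.
Proof.
move=> phi_f f2 wS; rewrite hom_ext_half //.
rewrite (hom_val_fun phi_f) ?double_sGamma //.
by rewrite f2 mulrAC divff ?mul1r // (natF_neq0 charF0 1).
Qed.

Lemma delta_coefE (phi : {additive subgroup Gamma -> F}) (b : basis Gamma s) :
  delta_coef phi b = hom_ext phi (weight b).
Proof.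
case: b => [x|x|u|] /=; rewrite /hom_ext.
- by rewrite (valP x) hom_val_val.
- by rewrite (negPf (coset_notin s_notin _)) //; apply: (valP x).
- by [].
- have -> : hom_val phi 0 = 0.
    by rewrite (hom_valE _ (rpred0 _)) -[RHS](raddf0 phi); congr (phi _);
       apply: val_inj; rewrite SubK.
  by rewrite rpred0.
Qed.

Lemma exists_additive (f : F -> F) : {in Gamma &, {morph f : x y / x + y}} ->
  exists phi : {additive subgroup Gamma -> F}, forall y, phi y = f (val y).
Proof.
move=> fD; pose g (y : subgroup Gamma) := f (val y).
have f0 : f 0 = 0.
  by apply: (addIr (f 0)); rewrite -fD ?rpred0 // !add0r.
have gD : nmod_morphism g.
  split=> [|x y]; rewrite /g; first by rewrite raddf0.
  by rewrite raddfD fD //; apply: valP.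
pose gA := GRing.isNmodMorphism.Build _ _ g gD.
pose phi : {additive subgroup Gamma -> F} := HB.pack g gA.
by exists phi.
Qed.

End HomExt.

(** * Spaces with a basis *)

(** [vec_ind] expresses that x is spanned by the basis vectors on which its
    coordinates do not vanish; [ext f] is the linear map with values f on the
    basis. *)
Record is_basis (F : fieldType) (B : eqType) (V : lmodType F)
    (vec : B -> V) (coef : B -> V -> F) (ext : (B -> V) -> V -> V) : Prop := {
  coef_lin : forall b (a : F) (x y : V),
    coef b (a *: x + y) = a * coef b x + coef b y;
  coef_vec : forall b c, coef c (vec b) = (b == c)%:R;
  vec_ind : forall (P : V -> Prop) x, P 0 ->
    (forall (a : F) b y, coef b x != 0 -> P y -> P (a *: vec b + y)) -> P x;
  ext_lin : forall f, linear (ext f);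
  ext_vec : forall f b, ext f (vec b) = f b
}.

Section Coordinates.

Variables (F : fieldType) (B : eqType) (V : lmodType F).
Variables (vec : B -> V) (coef : B -> V -> F) (ext : (B -> V) -> V -> V).
Hypothesis Vbasis : is_basis vec coef ext.

Lemma coef0 b : coef b 0 = 0.
Proof.
have := coef_lin Vbasis b (-1) 0 0.
by rewrite scaler0 addr0 mulN1r addNr.
Qed.

Lemma coefD b (x y : V) : coef b (x + y) = coef b x + coef b y.
Proof. by have := coef_lin Vbasis b 1 x y; rewrite scale1r mul1r. Qed.

Lemma coefZ b (a : F) (x : V) : coef b (a *: x) = a * coef b x.
Proof. by have := coef_lin Vbasis b a x 0; rewrite coef0 !addr0. Qed.

Lemma coefB b (x y : V) : coef b (x - y) = coef b x - coef b y.
Proof. by rewrite -scaleN1r coefD coefZ mulN1r. Qed.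

Lemma coefP (x y : V) : (forall b, coef b x = coef b y) -> x = y.
Proof.
move=> xy; apply/eqP; rewrite -subr_eq0; apply/eqP.
apply: (vec_ind Vbasis (P := fun z => z = 0)) => // a b z.
by rewrite coefB xy subrr eqxx.
Qed.

Lemma lin_eq_basis (f g : V -> V) : linear f -> linear g ->
  (forall b, f (vec b) = g (vec b)) -> f =1 g.
Proof.
move=> fl gl fg x; apply: (vec_ind Vbasis (P := fun z => f z = g z)).
  by rewrite (lin0 fl) (lin0 gl).
by move=> a b y _ IH; rewrite fl gl fg IH.
Qed.

End Coordinates.

(** * The derivation algebra *)

Section DerivationAlgebra.

Variables (F : fieldType) (charF0 : [pchar F] =i pred0).
Variables (Gamma : zmodClosed F) (s : F).
Hypotheses (s_notin : s \notin Gamma) (s2_in : 2 * s \in Gamma).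

Local Notation B := (basis Gamma s).
Local Notation sGamma := (in_sGamma Gamma s).

Local Notation eidx := (eidx Gamma s).
Local Notation gidx := (gidx Gamma s).

Variables (V : lmodType F) (br : V -> V -> V) (E G : F -> V) (C : V).
Hypothesis rel : N2_relations Gamma s br E G C.
Variables (vec : B -> V) (coef : B -> V -> F) (ext : (B -> V) -> V -> V).
Hypothesis Vbasis : is_basis vec coef ext.
Hypothesis E_vec : forall w, w \in sGamma -> E w = vec (eidx w).
Hypothesis G_vec : forall w, w \in sGamma -> G w = vec (gidx w).
Hypothesis C_vec : C = vec BasisC.
Variable hom : bool -> V -> Prop.
Hypothesis homP : forall q x,
  hom q x <-> (forall b, parity b != q -> coef b x = 0).

Let br_linl := N2_linl rel.
Let br_linr := N2_linr rel.
Let brCl := N2_Cl rel.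
Let brCr := N2_Cr rel.
Let brEE := N2_EE rel.
Let brEG := N2_EG rel.
Let brGE := N2_GE rel.
Let brGG := N2_GG rel.
Let coef0 := coef0 Vbasis.
Let coefD := coefD Vbasis.
Let coefZ := coefZ Vbasis.
Let coefB := coefB Vbasis.
Let coef_vec := coef_vec Vbasis.
Let S0 : 0 \in sGamma := mem_sGamma0 Gamma s.
Let sS : s \in sGamma := mem_sGamma_s Gamma s.

(** Case analysis on a basis vector that keeps track of its parity and weight. *)
Lemma basisU_ind (P : bool -> F -> V -> Prop) :
    (forall w, w \in sGamma -> P false w (E w)) ->
    (forall w, w \in sGamma -> P true w (G w)) -> P false 0 C ->
  forall b, P (parity b) (weight b) (vec b).
Proof.
move=> PE PG PC.
apply: (basis_cases s_notin (P := fun b => P (parity b) (weight b) (vec b))) =>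
  [w wS|w wS|].
- by rewrite parity_eidx (weight_eidx s_notin wS) -(E_vec wS); apply: PE.
- by rewrite (parity_gidx wS) (weight_gidx wS) -(G_vec wS); apply: PG.
- by rewrite -C_vec.
Qed.

Lemma hom_coef q x b : hom q x -> coef b x != 0 -> parity b = q.
Proof. by move/homP=> hx; apply: contraNeq => /hx/eqP. Qed.

Lemma hom_lin q a x y : hom q x -> hom q y -> hom q (a *: x + y).
Proof.
move=> /homP hx /homP hy; apply/homP => b bq.
by rewrite (coef_lin Vbasis) hx // hy // mulr0 addr0.
Qed.

Lemma hom0 q : hom q 0.
Proof. by apply/homP => b _; apply: coef0. Qed.

Lemma homZ q a x : hom q x -> hom q (a *: x).
Proof.
by move=> hx; rewrite -[_ *: x]addr0; apply: hom_lin => //; apply: hom0.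
Qed.

Lemma hom_vec b : hom (parity b) (vec b).
Proof.
apply/homP => c cb; rewrite coef_vec; case: eqP => // bc.
by rewrite bc eqxx in cb.
Qed.

Lemma homE w : w \in sGamma -> hom false (E w).
Proof.
by move=> wS; rewrite E_vec // -(parity_eidx Gamma s w); apply: hom_vec.
Qed.

Lemma homG w : w \in sGamma -> hom true (G w).
Proof. by move=> wS; rewrite G_vec // -(parity_gidx wS); apply: hom_vec. Qed.

Lemma homC : hom false C.
Proof. by rewrite C_vec; apply: (hom_vec BasisC). Qed.

Lemma hom_br_vec a b : hom (parity b (+) parity a) (br (vec a) (vec b)).
Proof.
move: a; apply: (basisU_ind
  (P := fun p _ v => hom (parity b (+) p) (br v (vec b)))).
- move=> x xS; move: b; apply: (basisU_ind
    (P := fun p _ v => hom (p (+) false) (br (E x) v))) => [y yS|u uS|] /=.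
  + rewrite brEE //; apply: hom_lin; first exact: homE (sGammaD s2_in xS yS).
    by apply: homZ; apply: homC.
  + by rewrite brEG //; apply: homZ; apply: homG; apply: sGammaD.
  + by rewrite brCr; apply: hom0.
- move=> u uS; move: b; apply: (basisU_ind
    (P := fun p _ v => hom (p (+) true) (br (G u) v))) => [x xS|v vS|] /=.
  + by rewrite brGE //; apply: homZ; apply: homG; apply: sGammaD.
  + rewrite brGG //; apply: hom_lin; first exact: homE (sGammaD s2_in uS vS).
    by apply: homZ; apply: homC.
  + by rewrite brCr; apply: hom0.
- by rewrite brCl; apply: hom0.
Qed.

(** The sign in the Leibniz rule only depends on the parity of the first
    argument, and both sides are bilinear. *)
Lemma derivation_basis p (d : V -> V) : linear d ->
    (forall b, hom (parity b (+) p) (d (vec b))) ->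
    (forall a b, leibniz br ((-1) ^+ (p && parity a)) d (vec a) (vec b)) ->
  derivation hom br p d.
Proof.
move=> d_lin d_hom d_der; split=> // [q x hx|q r x y hx _].
  apply: (vec_ind Vbasis (P := fun z => hom (q (+) p) (d z))).
    by rewrite (lin0 d_lin); apply: hom0.
  move=> a b z bx hz; rewrite d_lin; apply: hom_lin => //.
  by rewrite -(hom_coef hx bx); apply: d_hom.
apply: (vec_ind Vbasis (P := fun z => leibniz br ((-1) ^+ (p && q)) d z y)).
  exact: (leibniz0l br_linl).
move=> a b z bx hz; apply: (leibniz_linl br_linl _ d_lin _ hz).
apply: (vec_ind Vbasis (P := fun t => leibniz br _ d (vec b) t)).
  exact: (leibniz0r br_linr).
move=> c b' t _ ht; apply: (leibniz_linr br_linr _ d_lin _ ht).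
by rewrite -(hom_coef hx bx); apply: d_der.
Qed.

Lemma jacobi_vec a b c :
  super_jacobi br (parity a) (parity b) (vec a) (vec b) (vec c).
Proof.
move: a; apply: (basisU_ind
  (P := fun p _ v => super_jacobi br p (parity b) v (vec b) (vec c)));
  last exact: (jacobiCl rel).
all: move=> x xS; move: b; apply: (basisU_ind
  (P := fun p _ v => super_jacobi br _ p _ v (vec c)));
  last exact: (jacobiCm rel).
all: move=> y yS; move: c; apply: (basisU_ind
  (P := fun _ _ v => super_jacobi br _ _ _ _ v)) => [z zS|z zS|].
- exact: (jacobiEEE charF0 s2_in rel).
- exact: (jacobiEEG charF0 s2_in rel).
- exact: (jacobiCr rel).
- exact: (jacobiEGE charF0 s2_in rel).
- exact: (jacobiEGG charF0 s2_in rel).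
- exact: (jacobiCr rel).
- exact: (jacobiGEE charF0 s2_in rel).
- exact: (jacobiGEG charF0 s2_in rel).
- exact: (jacobiCr rel).
- exact: (jacobiGGE charF0 s2_in rel).
- exact: (jacobiGGG charF0 s2_in rel).
- exact: (jacobiCr rel).
Qed.

Lemma derivation_ad p x : hom p x -> derivation hom br p (br x).
Proof.
move=> hx; apply: (vec_ind Vbasis (P := fun z => derivation hom br p (br z))).
  apply: (derivation_ext (e := fun=> 0)).
    by move=> y; apply: (lin0 (br_linl y)).
  exact: (derivation0 br_linl br_linr _ hom0).
move=> a b z bx hz.
apply: (derivation_ext (e := fun y => a *: br (vec b) y + br z y)).
  by move=> y; apply: (br_linl y).
apply: (derivation_lin br_linl br_linr hom_lin a _ hz).
rewrite -(hom_coef hx bx); apply: derivation_basis; first exact: br_linr.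
  by move=> c; apply: hom_br_vec.
by move=> c c'; apply: jacobi_vec.
Qed.

Definition diag (psi : F -> F) : V -> V :=
  ext (fun b => psi (weight b) *: vec b).

Lemma diag_vec psi b : diag psi (vec b) = psi (weight b) *: vec b.
Proof. exact: (ext_vec Vbasis). Qed.

Lemma diag_lin psi : linear (diag psi).
Proof. exact: (ext_lin Vbasis). Qed.

Lemma coef_diag psi x c : coef c (diag psi x) = psi (weight c) * coef c x.
Proof.
apply: (vec_ind Vbasis
  (P := fun z => coef c (diag psi z) = psi (weight c) * coef c z)).
  by rewrite (lin0 (diag_lin psi)) coef0 mulr0.
move=> a b y _ IH; rewrite (diag_lin psi) diag_vec !coefD !coefZ IH coef_vec.
rewrite mulrDr; congr (_ + _); case: eqP => [->|_].
  by rewrite !mulr1 mulrC.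
by rewrite !mulr0.
Qed.

Lemma diagE psi w : w \in sGamma -> diag psi (E w) = psi w *: E w.
Proof. by move=> wS; rewrite (E_vec wS) diag_vec (weight_eidx s_notin). Qed.

Lemma diagG psi w : w \in sGamma -> diag psi (G w) = psi w *: G w.
Proof. by move=> wS; rewrite (G_vec wS) diag_vec weight_gidx. Qed.

Lemma diagC psi : psi 0 = 0 -> diag psi C = 0.
Proof. by move=> psi0; rewrite C_vec diag_vec psi0 scale0r. Qed.

Lemma derivation_diag psi :
    {in sGamma &, {morph psi : x y / x + y}} ->
  derivation hom br false (diag psi).
Proof.
move=> psiD; have psi0 : psi 0 = 0.
  have := psiD 0 0 S0 S0; rewrite addr0 => /eqP.
  by rewrite -subr_eq0 opprD addNKr oppr_eq0 => /eqP.
have DE := @diagE psi; have DG := @diagG psi; have DC := diagC psi0.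
apply: derivation_basis; first exact: diag_lin.
  by move=> b; rewrite addbF diag_vec; apply: homZ; apply: hom_vec.
move=> a b; rewrite /leibniz /= expr0 scale1r; move: a; apply: (basisU_ind
  (P := fun _ _ v => diag psi (br v (vec b))
                     = br (diag psi v) (vec b) + br v (diag psi (vec b))));
  last by apply: (diag_derC rel (diag_lin psi) DC).
all: move=> x xS; move: b; apply: (basisU_ind
  (P := fun _ _ v =>
     diag psi (br _ v) = br (diag psi _) v + br _ (diag psi v)));
  last by apply: (diag_derCr rel (diag_lin psi) DC).
all: move=> y yS.
- exact: (diag_derEE s2_in rel (diag_lin psi) psiD DE DC).
- exact: (diag_derEG s2_in rel (diag_lin psi) psiD DE DG).
- exact: (diag_derGE s2_in rel (diag_lin psi) psiD DE DG).
- exact: (diag_derGG s2_in rel (diag_lin psi) psiD DE DG DC).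
Qed.

Lemma adE0_diag : br (E 0) =1 diag -%R.
Proof.
apply: (lin_eq_basis Vbasis); [exact: br_linr | exact: diag_lin |].
apply: (basisU_ind (P := fun _ _ v => br (E 0) v = diag -%R v)).
- by move=> w wS; rewrite diagE // (adE0E rel).
- by move=> w wS; rewrite diagG // (adE0G rel).
- by rewrite brCr diagC // oppr0.
Qed.

Lemma brE0_diag x : br x (E 0) = diag id x.
Proof.
move: x; apply: (lin_eq_basis Vbasis); [exact: br_linl | exact: diag_lin |].
apply: (basisU_ind (P := fun _ _ v => br v (E 0) = diag id v)).
- by move=> w wS; rewrite diagE // (brEE0 rel).
- by move=> w wS; rewrite diagG // (brGE0 rel).
- by rewrite brCl diagC.
Qed.

(** The weight space of weight w is spanned by E_w, G_w and, for w = 0, by c. *)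
Lemma weight_decomp w v : w \in sGamma ->
    (forall b, weight b != w -> coef b v = 0) ->
  v = coef (eidx w) v *: E w + coef (gidx w) v *: G w
      + (coef BasisC v * (w == 0)%:R) *: C.
Proof.
move=> wS vw; rewrite (E_vec wS) (G_vec wS) C_vec.
apply: (coefP Vbasis) => b; rewrite !coefD !coefZ !coef_vec.
move: b; apply: (basis_cases s_notin) => [x xS|x xS|].
- rewrite (eidx_eq s_notin wS xS) [gidx w == _]eq_sym (egidx_eq _ wS).
  rewrite [BasisC == _]eq_sym (eidxC s_notin xS) !mulr0 !addr0.
  have [->|wx] := eqVneq w x; first by rewrite mulr1.
  by rewrite mulr0 vw // (weight_eidx s_notin xS) eq_sym.
- rewrite (gidx_eq wS xS) (egidx_eq _ xS).
  rewrite [BasisC == _]eq_sym (gidxC xS) !mulr0 add0r addr0.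
  have [->|wx] := eqVneq w x; first by rewrite mulr1.
  by rewrite mulr0 vw // (weight_gidx xS) eq_sym.
- rewrite (eidxC s_notin wS) (gidxC wS) eqxx !mulr0 mulr1 !add0r.
  have [_|w0] := eqVneq w 0; first by rewrite mulr1.
  by rewrite mulr0 vw // eq_sym.
Qed.

(** Since [z, L_0] = w z for z of weight w, the components of d(L_0) of nonzero
    weight are brackets with L_0. *)
Lemma sub_inner_weight0 p (d : V -> V) : derivation hom br p d ->
  exists2 z : V, hom p z &
    forall c, weight c != 0 -> coef c (d (E 0) - br z (E 0)) = 0.
Proof.
case=> _ d_hom _.
(* each component of d(L_0) divided by its weight; the convention 0^-1 = 0 drops
   the one of weight 0 *)
exists (diag GRing.inv (d (E 0))).
  apply/homP => b bp; rewrite coef_diag.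
  have /homP -> // : hom p (d (E 0)).
    by apply: (d_hom false); apply: homE.
  by rewrite mulr0.
by move=> c c0; rewrite brE0_diag coefB !coef_diag mulVKf // subrr.
Qed.

Lemma indepE w a b : w \in sGamma -> a *: E w + b *: C = 0 -> a = 0 /\ b = 0.
Proof.
move=> wS; rewrite (E_vec wS) C_vec => ab; split.
  have := congr1 (coef (eidx w)) ab.
  rewrite coef0 coefD !coefZ !coef_vec eqxx.
  rewrite [BasisC == _]eq_sym (eidxC s_notin wS).
  by rewrite mulr1 mulr0 addr0.
have := congr1 (coef BasisC) ab.
rewrite coef0 coefD !coefZ !coef_vec eqxx (eidxC s_notin wS).
by rewrite mulr1 mulr0 add0r.
Qed.

Lemma indepG w a : w \in sGamma -> a *: G w = 0 -> a = 0.
Proof.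
move=> wS; rewrite (G_vec wS) => /(congr1 (coef (gidx w))).
by rewrite coef0 coefZ coef_vec eqxx mulr1.
Qed.

(** Applying d to [L_0, x] = - w x, for x of weight w, gives
    (v - w) d(x)_v = [d(L_0), x]_v in each weight v.  With x = T_s and v = s this
    shows that d(L_0) is a multiple of c, and then the right-hand side is 0 for
    all x. *)
Lemma weight_preserving p (d : V -> V) : derivation hom br p d ->
    (forall c, weight c != 0 -> coef c (d (E 0)) = 0) ->
  coef (eidx 0) (d (E 0)) = 0 /\
  forall b c, weight c != weight b -> coef c (d (vec b)) = 0.
Proof.
move=> [d_lin d_hom d_der] dE0.
have key b c : (weight c - weight b) * coef c (d (vec b))
    = coef c (br (d (E 0)) (vec b)).
  have dE := d_der false (parity b) _ _ (homE S0) (hom_vec b).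
  move: dE; rewrite andbF expr0 scale1r !adE0_diag diag_vec (linZ d_lin).
  move/(congr1 (coef c)); rewrite coefD coefZ coef_diag => e.
  by apply: (addIr (- weight c * coef c (d (vec b)))); rewrite -e; ring.
have dE0_def := weight_decomp S0 dE0.
have br_s c : weight c = s -> coef c (br (d (E 0)) (E s)) = 0.
  move=> cs; rewrite (E_vec sS) -key (weight_eidx s_notin sS) cs subrr mul0r.
  by [].
have val_s : br (d (E 0)) (E s)
    = - (coef (eidx 0) (d (E 0)) * s) *: E s + - coef (gidx 0) (d (E 0)) *: G s.
  by rewrite {1}dE0_def (weight0_Es s_notin rel).
have s0 : s != 0 := s_neq0 s_notin.
have a0 : coef (eidx 0) (d (E 0)) = 0.
  have := br_s _ (weight_eidx s_notin sS); rewrite val_s (E_vec sS) (G_vec sS).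
  rewrite coefD !coefZ !coef_vec eqxx [gidx s == _]eq_sym (egidx_eq _ sS).
  rewrite mulr1 mulr0 addr0 => /eqP.
  by rewrite oppr_eq0 mulf_eq0 (negPf s0) orbF => /eqP.
have b0 : coef (gidx 0) (d (E 0)) = 0.
  have := br_s _ (weight_gidx sS); rewrite val_s (E_vec sS) (G_vec sS).
  rewrite coefD !coefZ !coef_vec eqxx (egidx_eq _ sS).
  by rewrite mulr1 mulr0 add0r => /eqP; rewrite oppr_eq0 => /eqP.
split=> // b c bc; have := key b c.
rewrite dE0_def a0 b0 !scale0r !add0r (linZ (br_linl (vec b))).
rewrite brCl scaler0 coef0.
by move/eqP; rewrite mulf_eq0 subr_eq0 (negPf bc) => /eqP.
Qed.

Lemma even_decomp w v : w \in sGamma -> hom false v ->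
    (forall b, weight b != w -> coef b v = 0) ->
  v = coef (eidx w) v *: E w + (coef BasisC v * (w == 0)%:R) *: C.
Proof.
move=> wS /homP v_even vw; rewrite {1}(weight_decomp wS vw).
by rewrite (v_even (gidx w)) ?parity_gidx // scale0r addr0.
Qed.

Lemma odd_decomp w v : w \in sGamma -> hom true v ->
  (forall b, weight b != w -> coef b v = 0) -> v = coef (gidx w) v *: G w.
Proof.
move=> wS /homP v_odd vw; rewrite {1}(weight_decomp wS vw).
rewrite (v_odd (eidx w)) ?parity_eidx // (v_odd BasisC) //.
by rewrite mul0r !scale0r add0r addr0.
Qed.

Lemma inner_reduction p d : derivation hom br p d ->
  exists z d', [/\ forall x, d x = br z x + d' x, derivation hom br p d',
      coef (eidx 0) (d' (E 0)) = 0
    & forall b c, weight c != weight b -> coef c (d' (vec b)) = 0].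
Proof.
move=> d_der; have [z hz dz] := sub_inner_weight0 d_der.
pose d' x := (-1) *: br z x + d x.
have d'_der : derivation hom br p d'.
  apply: (derivation_lin br_linl br_linr hom_lin) => //.
  exact: derivation_ad.
have [|d'0 d'w] := weight_preserving d'_der.
  by move=> c c0; rewrite /d' scaleN1r addrC; apply: dz.
exists z, d'; split=> // x.
by rewrite /d' scaleN1r addrA subrr add0r.
Qed.

Definition delta_map (phi : {additive subgroup Gamma -> F}) : V -> V :=
  ext (fun b => delta_coef phi b *: vec b).

Lemma delta_map_vec phi b :
  delta_map phi (vec b) = hom_ext phi (weight b) *: vec b.
Proof. by rewrite /delta_map (ext_vec Vbasis) (delta_coefE s_notin). Qed.

Lemma delta_map_diag phi : delta_map phi =1 diag (hom_ext phi).
Proof.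
apply: (lin_eq_basis Vbasis); [exact: (ext_lin Vbasis) | exact: diag_lin |].
by move=> b; rewrite delta_map_vec diag_vec.
Qed.

Lemma derivation_delta phi : derivation hom br false (delta_map phi).
Proof.
apply: (derivation_ext (e := diag (hom_ext phi))); first exact: delta_map_diag.
by apply: derivation_diag; apply: (hom_extD charF0 s2_in).
Qed.

Lemma even_derivation d : derivation hom br false d ->
  exists z phi, forall x, d x = br z x + delta_map phi x.
Proof.
move=> /inner_reduction[z [d' [d_def d'_der d'0 d'w]]].
have [d_lin d_hom d_leib] := d'_der.
pose f w := coef (eidx w) (d' (E w)); pose h w := coef (gidx w) (d' (G w)).
have wE w b : w \in sGamma -> weight b != w -> coef b (d' (E w)) = 0.
  by move=> wS bw; rewrite (E_vec wS) d'w // (weight_eidx s_notin wS).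
have wG w b : w \in sGamma -> weight b != w -> coef b (d' (G w)) = 0.
  by move=> wS bw; rewrite (G_vec wS) d'w // weight_gidx.
have dE w : w \in sGamma ->
    d' (E w) = f w *: E w + (coef BasisC (d' (E 0)) * (w == 0)%:R) *: C.
  move=> wS; rewrite (even_decomp wS (d_hom _ _ (homE wS))) => [|b bw].
    by rewrite /f; have [->|] := eqVneq w 0; rewrite ?mulr0.
  exact: wE.
have dG w : w \in sGamma -> d' (G w) = h w *: G w.
  move=> wS; apply: (odd_decomp wS (d_hom _ _ (homG wS))) => b bw.
  exact: wG.
have dC : d' C = coef (eidx 0) (d' C) *: E 0 + coef BasisC (d' C) *: C.
  rewrite {1}(even_decomp S0 (d_hom _ _ homC)) ?eqxx ?mulr1 // => b b0.
  by rewrite C_vec d'w.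
have dEG x u : x \in sGamma -> u \in sGamma ->
    d' (br (E x) (G u)) = br (d' (E x)) (G u) + br (E x) (d' (G u)).
  move=> xS uS; have := d_leib _ _ _ _ (homE xS) (homG uS).
  by rewrite scale1r.
have dGG u v : u \in sGamma -> v \in sGamma ->
    d' (br (G u) (G v)) = br (d' (G u)) (G v) + br (G u) (d' (G v)).
  move=> uS vS; have := d_leib _ _ _ _ (homG uS) (homG vS).
  by rewrite scale1r.
have dCE : d' (br C (E s)) = br (d' C) (E s) + br C (d' (E s)).
  have := d_leib _ _ _ _ homC (homE sS).
  by rewrite scale1r.
have [d'E d'G d'C hD] := even_eigen charF0 s_notin s2_in rel indepE indepG
  d_lin dE dG dC dCE dEG dGG d'0.
have [x y xG yG|phi phi_h] := @exists_additive _ Gamma h.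
  by apply: hD; apply: Gamma_sGamma.
have phi_ext w : w \in sGamma -> hom_ext phi w = h w.
  move=> wS; apply: (hom_ext_fun charF0 s2_in phi_h _ wS).
  by rewrite mulr_natl mulr2n hD // -mulr2n mulr_natl.
exists z, phi => x; rewrite d_def; congr (_ + _).
rewrite delta_map_diag; move: x.
apply: (lin_eq_basis Vbasis d_lin (diag_lin _)).
apply: (basisU_ind (P := fun _ _ v => d' v = diag (hom_ext phi) v)).
- by move=> w wS; rewrite d'E // diagE // phi_ext.
- by move=> w wS; rewrite d'G // diagG // phi_ext.
- by rewrite d'C diagC // -(delta_coefE s_notin phi BasisC).
Qed.

Lemma odd_derivation d : derivation hom br true d -> exists z, d =1 br z.
Proof.
move=> /inner_reduction[z [d' [d_def d'_der _ d'w]]].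
have [d_lin d_hom d_leib] := d'_der.
pose f w := coef (gidx w) (d' (E w)); pose h w := coef (eidx w) (d' (G w)).
have wE w b : w \in sGamma -> weight b != w -> coef b (d' (E w)) = 0.
  by move=> wS bw; rewrite (E_vec wS) d'w // (weight_eidx s_notin wS).
have wG w b : w \in sGamma -> weight b != w -> coef b (d' (G w)) = 0.
  by move=> wS bw; rewrite (G_vec wS) d'w // weight_gidx.
have dG w : w \in sGamma ->
    d' (G w) = h w *: E w + (coef BasisC (d' (G 0)) * (w == 0)%:R) *: C.
  move=> wS; rewrite (even_decomp wS (d_hom _ _ (homG wS))) => [|b bw].
    by rewrite /h; have [->|] := eqVneq w 0; rewrite ?mulr0.
  exact: wG.
have dE w : w \in sGamma -> d' (E w) = f w *: G w.
  move=> wS; apply: (odd_decomp wS (d_hom _ _ (homE wS))) => b bw.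
  exact: wE.
have dC : d' C = coef (gidx 0) (d' C) *: G 0.
  apply: (odd_decomp S0 (d_hom _ _ homC)) => b b0.
  by rewrite C_vec d'w.
have dEE x y : x \in sGamma -> y \in sGamma ->
    d' (br (E x) (E y)) = br (d' (E x)) (E y) + br (E x) (d' (E y)).
  move=> xS yS; have := d_leib _ _ _ _ (homE xS) (homE yS).
  by rewrite scale1r.
have dEG x u : x \in sGamma -> u \in sGamma ->
    d' (br (E x) (G u)) = br (d' (E x)) (G u) + br (E x) (d' (G u)).
  move=> xS uS; have := d_leib _ _ _ _ (homE xS) (homG uS).
  by rewrite scale1r.
have dCE : d' (br C (E s)) = br (d' C) (E s) + br C (d' (E s)).
  have := d_leib _ _ _ _ homC (homE sS).
  by rewrite scale1r.
have [a [d'E d'G d'C]] := odd_inner charF0 s_notin s2_in rel indepE indepG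
  d_lin dE dG dC dCE dEE dEG.
exists (z + a *: G 0) => x; rewrite d_def (linD (br_linl x)); congr (_ + _).
move: x; apply: (lin_eq_basis Vbasis d_lin (br_linr _)).
by apply: (basisU_ind (P := fun _ _ v => d' v = br (a *: G 0) v)).
Qed.

Lemma hom_split x : exists x0 x1, [/\ hom false x0, hom true x1 & x = x0 + x1].
Proof.
apply: (vec_ind Vbasis
  (P := fun z => exists x0 x1, [/\ hom false x0, hom true x1 & z = x0 + x1])).
  by exists 0, 0; rewrite addr0; split=> //; apply: hom0.
move=> a b y _ [x0 [x1 [h0 h1 ->]]]; have := hom_vec b.
case: (parity b) => hb.
  exists x0, (a *: vec b + x1); split=> //; first exact: hom_lin.
  by rewrite addrCA.
exists (a *: vec b + x0), x1; split=> //; first exact: hom_lin.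
by rewrite addrA.
Qed.

Lemma Der_inner_delta d :
  Der hom br d <->
  sum_maps (inner br) (fun d' => exists phi, d' =1 delta_map phi) d.
Proof.
split.
  case=> d0 [d1 [/even_derivation[z0 [phi d0E]] /odd_derivation[z1 d1E] dE]].
  exists (br (z0 + z1)), (delta_map phi); split; [by exists (z0 + z1)
    | by exists phi | move=> x].
  by rewrite dE d0E d1E (linD (br_linl x)) addrAC.
case=> a [b [[x aE] [phi bE] dE]].
have [x0 [x1 [h0 h1 x_def]]] := hom_split x.
exists (fun y => 1 *: br x0 y + delta_map phi y), (br x1); split.
- apply: (derivation_lin br_linl br_linr hom_lin); first exact: derivation_ad.
  exact: derivation_delta.
- exact: derivation_ad.
- by move=> y; rewrite dE aE bE x_def (linD (br_linl y)) scale1r addrAC.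
Qed.

Lemma delta_map_inj (phi psi : {additive subgroup Gamma -> F}) :
  delta_map phi =1 delta_map psi -> phi =1 psi.
Proof.
move=> e x; have := congr1 (coef (BasisL x)) (e (vec (BasisL x))).
by rewrite /delta_map !(ext_vec Vbasis) !coefZ coef_vec eqxx !mulr1.
Qed.

(** delta_phi kills L_0 and G_0.  So ad x = delta_phi puts x in weight 0, and
    [G_0, G_0] = 2 L_0 - c / 12 rules out a component along G_0. *)
Lemma inner_delta_cap d :
  (inner br d /\ (exists phi, d =1 delta_map phi)) <->
  exists a : F, forall y, d y = a *: br (E 0) y.
Proof.
split=> [[[x dx] [phi d_phi]]|[a da]].
  have ext0 : hom_ext phi 0 = 0 by rewrite -(delta_coefE s_notin phi BasisC).
  have x0 c : weight c != 0 -> coef c x = 0.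
    move=> c0; have := brE0_diag x; rewrite -dx d_phi delta_map_diag diagE //.
    move/(congr1 (coef c)); rewrite coef_diag ext0 scale0r coef0 => /esym/eqP.
    by rewrite mulf_eq0 (negPf c0) => /eqP.
  have x_def := weight_decomp S0 x0.
  have b0 : coef (gidx 0) x = 0.
    have : br x (G 0) = 0.
      by rewrite -dx d_phi delta_map_diag diagG // ext0 scale0r.
    by rewrite {1}x_def => /(weight0_G0 charF0 rel indepE).
  exists (coef (eidx 0) x) => y; rewrite dx {1}x_def b0 scale0r addr0.
  rewrite (linD (br_linl y)) !(linZ (br_linl y)) brCl.
  by rewrite scaler0 addr0.
have daE : d =1 br (a *: E 0) by move=> y; rewrite da (linZ (br_linl y)).
split; first by exists (a *: E 0).
have [x y _ _|phi phi_a] := @exists_additive _ Gamma (fun x => - (a * x)).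
  by rewrite mulrDr opprD.
exists phi => y; rewrite daE delta_map_diag; move: y.
apply: (lin_eq_basis Vbasis (br_linr _) (diag_lin _)).
have phi_ext w : w \in sGamma -> hom_ext phi w = - (a * w).
  move=> wS; apply: (hom_ext_fun charF0 s2_in (f := fun x => - (a * x))) => //.
  by rewrite mulrN mulrCA.
apply: (basisU_ind (P := fun _ _ v => br (a *: E 0) v = diag (hom_ext phi) v)).
- move=> w wS; rewrite diagE // (linZ (br_linl _)) (adE0E rel) // scalerA.
  by rewrite phi_ext // mulrN.
- move=> w wS; rewrite diagG // (linZ (br_linl _)) (adE0G rel) // scalerA.
  by rewrite phi_ext // mulrN.
- by rewrite brCr diagC // -(delta_coefE s_notin phi BasisC).
Qed.

End DerivationAlgebra.

(** * The twisted N = 2 superconformal algebra *)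

Section TwistedN2.

Variables (F : fieldType) (Gamma : zmodClosed F) (s : F).
Hypotheses (s_notin : s \notin Gamma) (s2_in : 2 * s \in Gamma).

Local Notation V := (tN2 Gamma s).
Local Notation B := (basis Gamma s).
Local Notation br := (@bracket F Gamma s).
Local Notation hom := (@tN2_hom F Gamma s).
Local Notation sGamma := (in_sGamma Gamma s).
Local Notation eidx := (eidx Gamma s).
Local Notation gidx := (gidx Gamma s).

Definition basis_vec (b : B) : V := << b >>.

Definition basis_coef (b : B) (v : V) : F := v@_b.

Lemma linear_extensionEw (f : B -> V) (x : V) (D : {fset B}) :
  (msupp x `<=` D)%fset ->
  linear_extension f x = \sum_(b <- D) x@_b *: f b.
Proof.
move=> xD; apply: (big_fset_incl _ xD) => b _ xb.
by rewrite (mcoeff_outdom xb) scale0r.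
Qed.

Lemma linear_extension_linear (f : B -> V) : linear (linear_extension f).
Proof.
move=> a x y; pose D := (msupp x `|` msupp y)%fset.
have xD : (msupp x `<=` D)%fset by apply: fsubsetUl.
have yD : (msupp y `<=` D)%fset by apply: fsubsetUr.
have zD : (msupp (a *: x + y) `<=` D)%fset.
  apply: fsubset_trans (msuppD_le _ _) _.
  by rewrite fsubUset yD andbT; apply: fsubset_trans (msuppZ_le _ _) xD.
rewrite !(@linear_extensionEw _ _ D) // scaler_sumr -big_split /=.
by apply: eq_bigr => b _; rewrite mcoeffD mcoeffZ scalerDl scalerA.
Qed.

Lemma linear_extensionU (f : B -> V) (b : B) :
  linear_extension f (basis_vec b) = f b.
Proof.
rewrite /linear_extension /basis_vec msuppU oner_eq0.
by rewrite big_seq_fset1 mcoeffUU scale1r.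
Qed.

Lemma tN2_basis : is_basis basis_vec basis_coef (@linear_extension F Gamma s).
Proof.
split.
- by move=> b a x y; rewrite /basis_coef mcoeffD mcoeffZ.
- by move=> b c; rewrite /basis_coef /basis_vec mcoeffU.
- move=> P x P0 PD.
  have -> : x = \sum_(b <- msupp x) basis_coef b x *: basis_vec b.
    rewrite {1}[x]monalgE; apply: eq_bigr => b _.
    apply/malgP => c; rewrite mcoeffU mcoeffZ.
    have -> : (basis_vec b)@_c = (b == c)%:R by rewrite /basis_vec mcoeffU.
    by rewrite mulr_natr.
  suff sumP (r : seq B) : {subset r <= msupp x} ->
    P (\sum_(b <- r) basis_coef b x *: basis_vec b) by apply: sumP.
  elim: r => [|b r IHr] rx; first by rewrite big_nil.
  rewrite big_cons; apply: PD.
    by rewrite /basis_coef mcoeff_neq0; apply: rx; rewrite mem_head.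
  by apply: IHr => c rc; apply: rx; rewrite inE rc orbT.
- exact: linear_extension_linear.
- exact: linear_extensionU.
Qed.

Lemma tN2_homP q (x : V) :
  hom q x <-> (forall b, parity b != q -> basis_coef b x = 0).
Proof.
split=> [hx b bq|hx b].
  by apply/eqP; rewrite mcoeff_eq0; apply: contra bq => /hx/eqP.
by apply: contraTeq => bq; rewrite -mcoeff_eq0; apply/eqP; apply: hx.
Qed.

Definition tE (w : F) : V :=
  if w \in Gamma then tL Gamma s w else tT Gamma s w.

Local Notation E := tE.
Local Notation G := (tG Gamma s).
Local Notation C := (tC Gamma s).

Lemma tE_vec w : w \in sGamma -> E w = basis_vec (eidx w).
Proof.
move=> wS; rewrite /tE; case: (sGammaP s_notin wS) => x ->.
  by rewrite /tL valK.
by rewrite /tT valK.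
Qed.

Lemma tG_vec u : u \in sGamma -> G u = basis_vec (gidx u).
Proof. by move=> uS; rewrite /tG /gidx (insubT (in_sGamma Gamma s) uS). Qed.

Lemma br_linl y : linear (br^~ y).
Proof. by move=> a x z; apply: linear_extension_linear. Qed.

Lemma br_linr x : linear (br x).
Proof.
move=> a y z; rewrite /bracket /linear_extension scaler_sumr -big_split /=.
apply: eq_bigr => b _.
have := linear_extension_linear (bracket_basis b) a y z.
by rewrite /linear_extension => ->; rewrite scalerDr !scalerA mulrC.
Qed.

Lemma bracket_vec a b : br (basis_vec a) (basis_vec b) = bracket_basis a b.
Proof. by rewrite /bracket !linear_extensionU. Qed.

Lemma tC_vec : C = basis_vec BasisC. Proof. by []. Qed.

Lemma brCl x : br C x = 0.
Proof.
apply: (lin_eq_basis tN2_basis (f := br C) (g := fun=> 0)) => [|a y z|b].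
- exact: br_linr.
- by rewrite scaler0 addr0.
- by rewrite tC_vec bracket_vec.
Qed.

Lemma brCr x : br x C = 0.
Proof.
apply: (lin_eq_basis tN2_basis (f := br^~ C) (g := fun=> 0)) => [|a y z|b].
- exact: br_linl.
- by rewrite scaler0 addr0.
- by rewrite tC_vec bracket_vec; case: b.
Qed.

Lemma brEE x y : x \in sGamma -> y \in sGamma ->
  br (E x) (E y) = coefEE Gamma x y *: E (x + y)
                   + (cocycleE Gamma x * (x + y == 0)%:R) *: C.
Proof.
move=> xS yS; have xyG := GammaD s2_in xS yS.
have xy0 := @addr_eq0_Gamma _ Gamma x y.
rewrite (tE_vec xS) (tE_vec yS) bracket_vec /coefEE /cocycleE /tE.
case: (sGammaP s_notin xS) xyG xy0 => a ->;
  case: (sGammaP s_notin yS) => b -> /= -> xy0 //=.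
- have -> : (val a + val b == 0) = false by apply/eqP => /xy0.
  by rewrite mulr0 scale0r addr0 [val b + _]addrC.
- have -> : (val a + val b == 0) = false by apply/eqP => /xy0.
  by rewrite mulr0 scale0r addr0.
- by rewrite scale0r add0r.
Qed.

Lemma brEG x u : x \in sGamma -> u \in sGamma ->
  br (E x) (G u) = coefEG Gamma x u *: G (x + u).
Proof.
move=> xS uS; rewrite (tE_vec xS) (tG_vec uS) bracket_vec /coefEG.
rewrite /gidx (insubT (in_sGamma Gamma s) uS).
case: (sGammaP s_notin xS) => a -> /=; rewrite [u + _]addrC //.
by rewrite scale1r.
Qed.

Lemma brGE x u : x \in sGamma -> u \in sGamma ->
  br (G u) (E x) = - coefEG Gamma x u *: G (u + x).
Proof.
move=> xS uS; rewrite (tE_vec xS) (tG_vec uS) bracket_vec /coefEG.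
rewrite /gidx (insubT (in_sGamma Gamma s) uS).
case: (sGammaP s_notin xS) => a -> //=.
by rewrite scaleN1r.
Qed.

Lemma brGG u v : u \in sGamma -> v \in sGamma ->
  br (G u) (G v) = coefGG Gamma u v *: E (u + v)
                   + (cocycleG Gamma u * (u + v == 0)%:R) *: C.
Proof.
move=> uS vS; have uvG := GammaD s2_in uS vS.
have uv0 := @addr_eq0_Gamma _ Gamma u v.
rewrite (tG_vec uS) (tG_vec vS) bracket_vec /gidx.
rewrite !(insubT (in_sGamma Gamma s) _) //= /bracket_GG /=.
rewrite /coefGG /cocycleG /tE uvG.
case: (boolP (u \in Gamma)) uv0 => uG; case: (boolP (v \in Gamma)) => vG /= uv0.
- by rewrite mul1r.
- have -> : (u + v == 0) = false by apply/eqP => /uv0.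
  by rewrite mulr0 scale0r addr0.
- have -> : (u + v == 0) = false by apply/eqP => /uv0.
  by rewrite mulr0 scale0r addr0.
- by rewrite mulN1r mulNr [X in _ = _ + X]scaleNr.
Qed.

Lemma tN2_relations : N2_relations Gamma s br E G C.
Proof.
split; [exact: br_linl | exact: br_linr | exact: brCl | exact: brCr
  | exact: brEE | exact: brEG | by move=> u x uS xS; apply: brGE
  | exact: brGG].
Qed.

End TwistedN2.

Theorem theorem4p1 (F : fieldType) (charF0 : [pchar F] =i pred0)
    (Gamma : zmodClosed F) (s : F) (s_notin : s \notin Gamma)
    (s2_in : 2 * s \in Gamma) :
  [/\ (* Der = ad + Hom *)
      forall d : tN2 Gamma s -> tN2 Gamma s,
        Der (@tN2_hom F Gamma s) (@bracket F Gamma s) d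
        <-> sum_maps (inner (@bracket F Gamma s))
                     (@hom_derivations F Gamma s) d,
      (* phi is determined by delta_phi *)
      forall phi psi : {additive subgroup Gamma -> F},
        delta s phi =1 delta s psi -> phi =1 psi
    & (* the two summands meet exactly in the line spanned by ad L_0 *)
      forall d : tN2 Gamma s -> tN2 Gamma s,
        (inner (@bracket F Gamma s) d /\ @hom_derivations F Gamma s d)
        <-> exists a : F, forall y, d y = a *: bracket (tL Gamma s 0) y].
Proof.
have rel := tN2_relations s_notin s2_in.
have Vbasis := tN2_basis Gamma s.
have EU := @tE_vec F Gamma s s_notin; have GU := @tG_vec F Gamma s.
have CU := @tC_vec F Gamma s.
have homP := @tN2_homP F Gamma s.
split.
- exact: (Der_inner_delta charF0 s_notin s2_in rel Vbasis EU GU CU homP).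
- exact: (delta_map_inj Vbasis).
- move=> d; have := inner_delta_cap charF0 s_notin s2_in rel Vbasis EU GU CU d.
  by rewrite /tE rpred0.
Qed.
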